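(* The MIN-UNCUT problem can be solved in polynomial time on almost bipartite graphs.
   Context: A graph $G=(V,E)$ (possibly with parallel edges) is almost bipartite if it is the union of a bipartite graph $H=(V_H,E_H)$ and two additional vertices $b,t$ whose edges may be incident to vertices of both parts of $H$; that is, $V=V_H\cup\{b,t\}$ and $E=E_H\cup E'$ with $E'\subseteq\{(b,v)\mid v\in V\}\cup\{(t,v)\mid v\in V\}$. MIN-UNCUT: given a graph, partition its vertex set into two sets $S_t,S_b$ so that the number of uncut edges, i.e. edges with both endpoints in $S_t$ or both in $S_b$, is minimized. *)

(* Defs.v *)
From HB Require Import structures.
From mathcomp Require Import all_boot all_order all_algebra.

Set Implicit Arguments.
Unset Strict Implicit.
Unset Printing Implicit Defensive.

(** * Random access machines with logarithmic cost

    Registers are indexed by nat and hold unbounded natural numbers.  The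
    instruction set has addition and truncated subtraction but no
    multiplication, and every instruction is charged the bit length of all the
    register indices and register contents it handles (the cost criterion of
    Aho, Hopcroft and Ullman), so that running time is polynomially related to
    Turing machine time. *)

Inductive instr : Type :=
  | Const of nat & nat
  | Add of nat & nat & nat
  | Sub of nat & nat & nat
  | Fetch of nat & nat
  | Store of nat & nat
  | Jump of nat
  | Jzero of nat & nat.

Definition program := seq instr.
Definition memory := nat -> nat.

Definition set_reg (m : memory) (d v : nat) : memory :=
  fun i => if i == d then v else m i.

Definition exec (i : instr) (pc : nat) (m : memory) : nat * memory :=
  match i with
  | Const d c => (pc.+1, set_reg m d c)
  | Add d a b => (pc.+1, set_reg m d (m a + m b))
  | Sub d a b => (pc.+1, set_reg m d (m a - m b))
  | Fetch d a => (pc.+1, set_reg m d (m (m a)))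
  | Store d a => (pc.+1, set_reg m (m d) (m a))
  | Jump l    => (l, m)
  | Jzero a l => (if m a == 0 then l else pc.+1, m)
  end.

Definition bitlen (n : nat) : nat := (trunc_log 2 n).+1.

Definition read_cost (m : memory) (a : nat) : nat := bitlen a + bitlen (m a).

Definition instr_cost (i : instr) (m : memory) : nat :=
  match i with
  | Const d c => bitlen d + bitlen c
  | Add d a b => bitlen d + read_cost m a + read_cost m b
  | Sub d a b => bitlen d + read_cost m a + read_cost m b
  | Fetch d a => bitlen d + read_cost m a + bitlen (m (m a))
  | Store d a => read_cost m d + read_cost m a
  | Jump l    => 1
  | Jzero a l => read_cost m a
  end.

(** [halts M pc m c m']: started at line [pc] with memory [m], the program [M]
    halts, by leaving its range of line numbers, with memory [m'] after a
    computation of total cost [c]. *)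
Inductive halts (M : program) : nat -> memory -> nat -> memory -> Prop :=
  | halts_stop pc m : size M <= pc -> halts M pc m 0 m
  | halts_step pc m i c m' :
      onth M pc = Some i ->
      halts M (exec i pc m).1 (exec i pc m).2 c m' ->
      halts M pc m (instr_cost i m + c) m'.

(** A word is stored with its length in register 0 and its letters in the
    registers 1, 2, ...; all the other registers initially hold 0. *)
Definition input_memory (w : seq nat) : memory := nth 0 (size w :: w).
Definition output_word (m : memory) : seq nat :=
  mkseq (fun i => m i.+1) (m 0).

Definition computes_in (M : program) (w out : seq nat) (c : nat) : Prop :=
  exists m, halts M 0 (input_memory w) c m /\ output_word m = out.

(** One fixed program answers every instance satisfying [inst]; nothing is
    required of it on other inputs. *)
Definition poly_time_solvable (I : Type) (inst : I -> Prop)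
    (encode : I -> seq nat) (inst_size : I -> nat)
    (solution : I -> seq nat -> Prop) : Prop :=
  exists (M : program) (p : {poly nat}), forall x : I, inst x ->
    exists (out : seq nat) (c : nat),
      [/\ computes_in M (encode x) out c,
          c <= (p.[inst_size x])%R
        & solution x out].

(** * Graphs with parallel edges

    An edge is a pair of endpoints whose order is irrelevant to all the notions
    below; parallel edges are repetitions in the list. *)

Record mgraph : Type := MGraph {
  nvertices : nat;
  edges : seq ('I_nvertices * 'I_nvertices) }.

Definition graph_size (G : mgraph) : nat := nvertices G + size (edges G).

Definition graph_word (G : mgraph) : seq nat :=
  nvertices G :: flatten [seq [:: nat_of_ord e.1; nat_of_ord e.2] | e <- edges G].

(** The graph with vertex set [W] and edge list [E] is bipartite. *)
Definition bipartite (V : finType) (W : {set V}) (E : seq (V * V)) : Prop :=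
  exists X Y : {set V},
    [/\ X :|: Y = W, [disjoint X & Y]
      & forall e, e \in E ->
          (e.1 \in X) && (e.2 \in Y) || (e.1 \in Y) && (e.2 \in X)].

Definition incident (V : finType) (v : V) (e : V * V) : bool :=
  (e.1 == v) || (e.2 == v).

Definition almost_bipartite (G : mgraph) : Prop :=
  exists (b t : 'I_(nvertices G)) (EH E' : seq ('I_(nvertices G) * 'I_(nvertices G))),
    [/\ b != t,
        perm_eq (edges G) (EH ++ E'),
        bipartite (~: [set b; t]) EH
      & forall e, e \in E' -> incident b e || incident t e].

(** * MIN-UNCUT

    A partition of the vertex set is given by [St], with [Sb] its complement. *)

Definition uncut (G : mgraph) (St Sb : {set 'I_(nvertices G)}) : nat :=
  count (fun e => (e.1 \in St) && (e.2 \in St) || (e.1 \in Sb) && (e.2 \in Sb))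
        (edges G).

Definition min_uncut (G : mgraph) (St : {set 'I_(nvertices G)}) : Prop :=
  forall S : {set 'I_(nvertices G)}, uncut St (~: St) <= uncut S (~: S).

Definition partition_word (n : nat) (St : {set 'I_n}) : seq nat :=
  [seq nat_of_bool (v \in St) | v <- enum 'I_n].

Definition min_uncut_solution (G : mgraph) (out : seq nat) : Prop :=
  exists St : {set 'I_(nvertices G)}, min_uncut St /\ out = partition_word St.

(* Main.v *)
Require Import Defs.
From mathcomp Require Import all_boot all_order all_algebra.
From mathcomp Require Import zify.
Import Defs.

(** In the double cover of [G] (nodes "v in S" and "v not in S", an edge [uv]
    joining "u in S" to "v not in S" and vice versa) a set [S] is a cut separating
    every node from its mate, of capacity twice the number of uncut edges. Once
    [b] and [t] are assigned, the rest of the cover splits into two components, so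
    a minimum cut is the sum of two assignments read on either component, and both
    are optimal. Hence any vertex may be assigned according to a minimum cut
    without loss, and assigning the vertices one after the other gives an optimal
    set. Minimum cuts are found by reversing paths from sources to sinks until none
    is left: a reversal lowers the out-degree of every separating set by one. The
    vertices [b] and [t] and their sides are guessed by exhaustive search, keeping
    the best set found. *)

Set Implicit Arguments.
Unset Strict Implicit.
Unset Printing Implicit Defensive.

(** * Structured programs on the machine *)

(** The bipartition of [H] is never computed: a colouring occurs only in the analysis. Wrong guesses
    are harmless, because the set they lead to is evaluated afresh on the edges before it is
    compared with the best one. The obstacle is that a minimum cut of the cover may contain both
    copies of a vertex or neither, so it need not be a vertex set; fixing a vertex forces
    consistency there, and this is repeated until every vertex is fixed. Reversed arcs are not
    restored between two fixings: a new fixing only shrinks the family of separating sets, and the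
    out-degrees of those that remain differ from the original ones by a common constant. A guess is
    a pair of nodes of the cover, which gives vertex and side at once. Every loop is bounded through
    the single number [64 * (size w + n)], which is also the address where the arrays begin; it
    exceeds the number [4 * m] of arcs, so that many augmentation rounds suffice. On the machine
    side, the input fills the very low registers that a program has to work in, hence the
    relocations at both ends. *)

Inductive runs (M : program) : nat -> nat -> memory -> nat -> memory -> Prop :=
  | runs_refl pc m : runs M 0 pc m pc m
  | runs_step k pc m i pc' m' :
      onth M pc = Some i ->
      runs M k (exec i pc m).1 (exec i pc m).2 pc' m' ->
      runs M k.+1 pc m pc' m'.

Lemma runs_trans M k1 k2 pc1 m1 pc2 m2 pc3 m3 :
  runs M k1 pc1 m1 pc2 m2 -> runs M k2 pc2 m2 pc3 m3 ->
  runs M (k1 + k2) pc1 m1 pc3 m3.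
Proof. by elim=> // k pc m i pc' m' Mi _ IH /IH; rewrite addSn; apply: runs_step. Qed.

Lemma runs1 M pc m i :
  onth M pc = Some i -> runs M 1 pc m (exec i pc m).1 (exec i pc m).2.
Proof. by move=> Mi; apply: (runs_step Mi); constructor. Qed.

(** Concerns the register indices and constants written in the program, which the cost criterion
    charges too. Jump targets stay free because line numbers are not charged. *)
Definition instr_below (K : nat) (i : instr) : bool :=
  match i with
  | Const d c => (d < 2 ^ K) && (c < 2 ^ K)
  | Add d a b => [&& d < 2 ^ K, a < 2 ^ K & b < 2 ^ K]
  | Sub d a b => [&& d < 2 ^ K, a < 2 ^ K & b < 2 ^ K]
  | Fetch d a => (d < 2 ^ K) && (a < 2 ^ K)
  | Store d a => (d < 2 ^ K) && (a < 2 ^ K)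
  | Jump l => true
  | Jzero a l => a < 2 ^ K
  end.

Lemma instr_below_leq K K' i : K <= K' -> instr_below K i -> instr_below K' i.
Proof.
move=> leK; have lt x : x < 2 ^ K -> x < 2 ^ K'.
  by move=> h; apply: leq_trans h _; rewrite leq_exp2l.
by case: i => //= *;
  repeat match goal with H : is_true (_ && _) |- _ => case/andP: H => ? ? end;
  rewrite ?lt.
Qed.

Lemma program_below (M : program) : exists K, all (instr_below K) M.
Proof.
elim: M => [|i M [K IH]]; first by exists 0.
have [K' Ki]: exists K', instr_below K' i.
  have lt x y : x <= y -> x < 2 ^ y by move=> h; apply: leq_ltn_trans h (ltn_expl _ _).
  case: i => [d c|d a b|d a b|d a|d a|l|a l] /=;
    [exists (d + c) | exists (d + a + b) | exists (d + a + b) | exists (d + a)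
    | exists (d + a) | exists 0 | exists a] => //;
  by rewrite ?lt //; lia.
exists (maxn K K') => /=; rewrite (instr_below_leq (leq_maxr _ _) Ki) /=.
by apply: sub_all IH => j; apply: instr_below_leq; apply: leq_maxl.
Qed.

Definition mem_below (k : nat) (m : memory) : Prop := forall i, m i < 2 ^ k.

Lemma bitlen_below k x : x < 2 ^ k -> bitlen x <= k.+1.
Proof.
move=> ltx; rewrite ltnS; case: (posnP x) => [->|x0]; first by rewrite trunc_log0.
rewrite -(leq_exp2l (m := 2)) //; apply: leq_trans (ltnW ltx).
exact: trunc_logP.
Qed.

Lemma exec_below K k i pc m :
  K <= k -> instr_below K i -> mem_below k m -> mem_below k.+1 (exec i pc m).2.
Proof.
move=> leKk /(instr_below_leq leKk) iK mk.
have mS x : m x < 2 ^ k.+1 by rewrite expnS; move: (mk x); lia.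
have set_below d v : v < 2 ^ k.+1 -> mem_below k.+1 (set_reg m d v).
  by move=> ltv j; rewrite /set_reg; case: ifP.
case: i iK => [d c|d a b|d a b|d a|d a|l|a l] //= iK; apply: set_below => //;
  rewrite ?expnS; try move: (mk a) (mk b); try lia.
Qed.

(** The factor 5 comes from [Add] and [Sub], which are charged for three indices and two
    contents. *)
Lemma instr_cost_below K k i m :
  K <= k -> instr_below K i -> mem_below k m -> instr_cost i m <= 5 * k.+1.
Proof.
move=> leKk /(instr_below_leq leKk) iK mk.
have mb x : bitlen (m x) <= k.+1 by apply: bitlen_below.
by case: i iK => [d c|d a b|d a b|d a|d a|l|a l] /= iK; rewrite /read_cost;
  repeat match goal with H : is_true (_ && _) |- _ => case/andP: H => ? ? end;
  repeat match goal with H : is_true (_ < 2 ^ k) |- _ => move/bitlen_below: H => ? end;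
  try have := mb a; try have := mb b; try have := mb d; try have := mb (m a); lia.
Qed.

(* A step at most doubles the largest value, so after [s] steps the operands
   have at most [k + s] bits: the logarithmic cost is quadratic in the number of
   steps, whatever the program computes. *)
Lemma runs_halts M K k s pc m pc' m' :
  all (instr_below K) M -> K <= k -> mem_below k m ->
  runs M s pc m pc' m' -> size M <= pc' ->
  exists2 c, halts M pc m c m' & c <= s * (5 * (k + s).+1).
Proof.
move=> MK leKk mk rM; elim: rM k leKk mk =>
  [{}pc {}m|{}s {}pc {}m i {}pc' {}m' Mi _ IH] k leKk mk lepc.
  by exists 0 => //; constructor.
have iK: instr_below K i.
  have ltpc: pc < size M by rewrite -onthTE Mi.
  have /(all_nthP (Const 0 0))/(_ pc ltpc) := MK.
  by rewrite (onth_nth (Const 0 0) _ _ _ Mi).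
have [c hc lec] := IH k.+1 (leqW leKk) (exec_below pc leKk iK mk) lepc.
exists (instr_cost i m + c); first exact: halts_step Mi hc.
have := instr_cost_below leKk iK mk; nia.
Qed.

(** * Structured commands and their compilation *)

Inductive cmd : Type :=
  | Skip
  | Prim of instr
  | Seq of cmd & cmd
  | If of nat & cmd & cmd
  | While of nat & cmd.

Definition straight (i : instr) : bool :=
  match i with Jump _ | Jzero _ _ => false | _ => true end.

(** The counter is the exact number of steps of the assembled code: the first branch of [If] pays
    for the test and for the jump over the second one, a pass through [While] for the test and the
    jump back. *)
Inductive ev : cmd -> memory -> nat -> memory -> Prop :=
  | ev_skip m : ev Skip m 0 m
  | ev_prim i m : straight i -> ev (Prim i) m 1 (exec i 0 m).2
  | ev_seq c1 c2 k1 k2 m1 m2 m3 :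
      ev c1 m1 k1 m2 -> ev c2 m2 k2 m3 -> ev (Seq c1 c2) m1 (k1 + k2) m3
  | ev_if_true r c1 c2 k m m' :
      m r != 0 -> ev c1 m k m' -> ev (If r c1 c2) m k.+2 m'
  | ev_if_false r c1 c2 k m m' :
      m r = 0 -> ev c2 m k m' -> ev (If r c1 c2) m k.+1 m'
  | ev_while_true r c k1 k2 m1 m2 m3 :
      m1 r != 0 -> ev c m1 k1 m2 -> ev (While r c) m2 k2 m3 ->
      ev (While r c) m1 (k1 + k2).+2 m3
  | ev_while_false r c m : m r = 0 -> ev (While r c) m 1 m.

(** Jumps are absolute, so the address [o] at which the code is loaded is a parameter. *)
Fixpoint asm (c : cmd) (o : nat) : program :=
  match c with
  | Skip => [::]
  | Prim i => [:: i]
  | Seq c1 c2 => let p1 := asm c1 o in p1 ++ asm c2 (o + size p1)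
  | If r c1 c2 =>
      let p1 := asm c1 o.+1 in
      let o2 := (o.+1 + size p1).+1 in
      let p2 := asm c2 o2 in
      Jzero r o2 :: p1 ++ Jump (o2 + size p2) :: p2
  | While r c =>
      let p := asm c o.+1 in Jzero r (o.+1 + size p).+1 :: p ++ [:: Jump o]
  end.

Definition code_at (M : program) (o : nat) (p : program) : Prop :=
  forall j i, onth p j = Some i -> onth M (o + j) = Some i.

Lemma code_at_cons M o i p :
  code_at M o (i :: p) -> onth M o = Some i /\ code_at M o.+1 p.
Proof.
move=> H; split; first by rewrite -(H 0 i) ?addn0.
by move=> j i' pj; rewrite addSnnS; apply: H.
Qed.

Lemma code_at_cat M o p1 p2 :
  code_at M o (p1 ++ p2) -> code_at M o p1 /\ code_at M (o + size p1) p2.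
Proof.
move=> H; split=> j i pj; last first.
  by rewrite -addnA; apply: H; rewrite onth_cat ltnNge leq_addr /= addKn.
apply: H; rewrite onth_cat; case: ltnP => // lej.
by rewrite onth_default in pj.
Qed.

Lemma asm_runs M c m k m' : ev c m k m' ->
  forall o, code_at M o (asm c o) -> runs M k o m (o + size (asm c o)) m'.
Proof.
elim=> {c m k m'}.
- by move=> m o _; rewrite addn0; constructor.
- move=> i m si o /code_at_cons[Mi _] /=; rewrite addn1.
  have := runs1 m Mi; by case: i si {Mi}.
- move=> c1 c2 k1 k2 m1 m2 m3 _ IH1 _ IH2 o /= /code_at_cat[M1 M2].
  by rewrite size_cat addnA; apply: runs_trans (IH1 _ M1) (IH2 _ M2).
- move=> r c1 c2 k m m' mr _ IH o /= /code_at_cons[Mj] /code_at_cat[M1].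
  move/code_at_cons=> [Mj' M2].
  apply: (runs_step Mj); rewrite /= (negPf mr) -addn1.
  apply: runs_trans (IH _ M1) _.
  have := runs1 m' Mj'; rewrite /= size_cat /=.
  by congr runs; lia.
- move=> r c1 c2 k m m' mr _ IH o /= /code_at_cons[Mj] /code_at_cat[M1].
  move/code_at_cons=> [Mj' M2].
  apply: (runs_step Mj); rewrite /= mr eqxx.
  have := IH _ M2; rewrite size_cat /=.
  by congr runs; lia.
- move=> r c k1 k2 m1 m2 m3 mr _ IH1 _ IH2 o Mw.
  have := Mw => /= /code_at_cons[Mj] /code_at_cat[M1] /code_at_cons[Mj' _].
  apply: (runs_step Mj); rewrite /= (negPf mr) -addnS.
  apply: runs_trans (IH1 _ M1) _; apply: (runs_step Mj').
  exact: IH2 Mw.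
- move=> r c m mr o /= /code_at_cons[Mj] _.
  have := runs1 m Mj; rewrite /= mr eqxx size_cat /=.
  by congr runs; lia.
Qed.

Definition prims (l : seq instr) : cmd := foldr (fun i c => Seq (Prim i) c) Skip l.

Definition exec_seq (l : seq instr) (m : memory) : memory :=
  foldl (fun m i => (exec i 0 m).2) m l.

Lemma ev_prims l m : all straight l -> ev (prims l) m (size l) (exec_seq l m).
Proof.
elim: l m => [|i l IH] m /=; first by constructor.
by case/andP=> si sl; rewrite -add1n; apply: ev_seq (ev_prim m si) (IH _ sl).
Qed.

(** [K] depends on the program alone, which makes the cost bound uniform in the input. *)
Theorem ev_halts c : exists K, forall m k s m',
  mem_below k m -> K <= k -> ev c m s m' ->
  exists2 cst, halts (asm c 0) 0 m cst m' & cst <= s * (5 * (k + s).+1).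
Proof.
have [K MK] := program_below (asm c 0); exists K => m k s m' mk leKk evc.
apply: (runs_halts MK leKk mk (asm_runs evc _)); first by move=> j i.
by rewrite add0n.
Qed.

(** * A loop language with arrays *)

(* [HFor] counts up to the value of a slot and keeps its counter in a new slot.
   Slots cannot be assigned, and [HLet] caps them by slot 0, so every program
   terminates within a polynomial in slot 0. *)
Inductive hcmd : Type :=
  | HSkip
  | HConst of nat & nat
  | HAdd of nat & nat & nat
  | HSub of nat & nat & nat
  | HGet of nat & nat & nat
  | HPut of nat & nat & nat
  | HSlot of nat & nat
  | HSeq of hcmd & hcmd
  | HIf of nat & hcmd & hcmd
  | HFor of nat & hcmd
  | HLet of nat & hcmd.

Arguments prims : simpl never.
Arguments exec_seq : simpl never.

Lemma exec_seq_rcons l i m : exec_seq (rcons l i) m = (exec i 0 (exec_seq l m)).2.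
Proof. by rewrite /exec_seq foldl_rcons. Qed.

Record state : Type := State { var : nat -> nat; arr : nat -> nat -> nat }.

Definition fupd (f : nat -> nat) (x v : nat) : nat -> nat :=
  fun y => if y == x then v else f y.

Definition set_var (s : state) (x v : nat) : state :=
  State (fupd (var s) x v) (arr s).

Definition set_arr (s : state) (a i v : nat) : state :=
  State (var s) (fun a' => if a' == a then fupd (arr s a) i v else arr s a').

(** Slots are de Bruijn levels: [d] of them are in scope, and a loop or [HLet] met at depth [d]
    binds slot [d]. *)
Fixpoint run (d : nat) (rho : nat -> nat) (c : hcmd) (s : state) : state :=
  match c with
  | HSkip => s
  | HConst x v => set_var s x v
  | HAdd x y z => set_var s x (var s y + var s z)
  | HSub x y z => set_var s x (var s y - var s z)
  | HGet x a y => set_var s x (arr s a (var s y))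
  | HPut a y x => set_arr s a (var s y) (var s x)
  | HSlot x k => set_var s x (rho k)
  | HSeq c1 c2 => run d rho c2 (run d rho c1 s)
  | HIf x c1 c2 => if var s x == 0 then run d rho c2 s else run d rho c1 s
  | HFor k c => iteri (rho k) (fun j => run d.+1 (fupd rho d j) c) s
  | HLet x c => run d.+1 (fupd rho d (minn (var s x) (rho 0))) c s
  end.

Fixpoint wf (d : nat) (c : hcmd) : bool :=
  match c with
  | HSkip => true
  | HConst x _ => x < 30
  | HAdd x y z | HSub x y z => [&& x < 30, y < 30 & z < 30]
  | HGet x a y => [&& x < 30, a < 8 & y < 30]
  | HPut a y x => [&& x < 30, a < 8 & y < 30]
  | HSlot x k => (x < 30) && (k < d)
  | HSeq c1 c2 => wf d c1 && wf d c2
  | HIf x c1 c2 => [&& x < 30, wf d c1 & wf d c2]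
  | HFor k c => [&& k < d, d < 30 & wf d.+1 c]
  | HLet x c => [&& x < 30, 0 < d < 30 & wf d.+1 c]
  end.

(** Registers 0 and 1 are scratch and register 2 holds the array base; variables take the odd and
    slots the even registers from 3 on. With at most thirty of each, all lie below 64. *)
Definition vreg (x : nat) := 3 + 2 * x.
Definition sreg (k : nat) := 4 + 2 * k.

(** Leaves the address [base + 8 * y + a] in register 0; three doublings stand for the
    multiplication by the stride. *)
Definition addr_code (a y : nat) : seq instr :=
  [:: Add 0 (vreg y) (vreg y); Add 0 0 0; Add 0 0 0; Add 0 0 2;
      Const 1 a; Add 0 0 1].

(** At a loop test register 0 holds the bound minus the counter; it is recomputed after the body,
    which uses register 0 as scratch. [HLet] obtains a minimum as [x - (x - y)] with truncated
    subtraction. *)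
Fixpoint hcomp (d : nat) (c : hcmd) : cmd :=
  match c with
  | HSkip => Skip
  | HConst x v => prims [:: Const (vreg x) v]
  | HAdd x y z => prims [:: Add (vreg x) (vreg y) (vreg z)]
  | HSub x y z => prims [:: Sub (vreg x) (vreg y) (vreg z)]
  | HGet x a y => prims (rcons (addr_code a y) (Fetch (vreg x) 0))
  | HPut a y x => prims (rcons (addr_code a y) (Store 0 (vreg x)))
  | HSlot x k => prims [:: Const 0 0; Add (vreg x) (sreg k) 0]
  | HSeq c1 c2 => Seq (hcomp d c1) (hcomp d c2)
  | HIf x c1 c2 => If (vreg x) (hcomp d c1) (hcomp d c2)
  | HFor k c =>
      Seq (prims [:: Const (sreg d) 0; Sub 0 (sreg k) (sreg d)])
          (While 0 (Seq (hcomp d.+1 c)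
            (prims [:: Const 1 1; Add (sreg d) (sreg d) 1;
                       Sub 0 (sreg k) (sreg d)])))
  | HLet x c =>
      Seq (prims [:: Sub 0 (vreg x) (sreg 0); Sub (sreg d) (vreg x) 0])
          (hcomp d.+1 c)
  end.

(** [B] bounds all slots. In a loop, 5 pays for the test, the jump back and the three counter
    instructions of a pass, and 3 for the initialisation and the last test. *)
Fixpoint time (c : hcmd) (B : nat) : nat :=
  match c with
  | HSkip => 0
  | HConst _ _ | HAdd _ _ _ | HSub _ _ _ => 1
  | HGet _ _ _ | HPut _ _ _ => 7
  | HSlot _ _ => 2
  | HSeq c1 c2 => time c1 B + time c2 B
  | HIf _ c1 c2 => (time c1 B + time c2 B).+2
  | HFor _ c => 3 + B * (time c B + 5)
  | HLet _ c => 2 + time c B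
  end.

(** Since [B.+2] is at least 2, a constant lies below one of its powers and a sum is absorbed by one
    more factor, so a single exponent does. *)
Lemma time_poly c : exists e, forall B, time c B <= B.+2 ^ e.
Proof.
have le e e' B : e <= e' -> B.+2 ^ e <= B.+2 ^ e' by move=> h; rewrite leq_exp2l.
have const k : exists e, forall B, k <= B.+2 ^ e.
  by exists k => B; apply/ltnW/ltn_expl.
have add (f g : nat -> nat) : (exists e, forall B, f B <= B.+2 ^ e) ->
    (exists e, forall B, g B <= B.+2 ^ e) ->
    exists e, forall B, f B + g B <= B.+2 ^ e.
  move=> [e1 H1] [e2 H2]; exists (maxn e1 e2).+1 => B; rewrite expnS.
  have := leq_trans (H1 B) (le _ _ B (leq_maxl e1 e2)).
  have := leq_trans (H2 B) (le _ _ B (leq_maxr e1 e2)); nia.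
elim: c => /=; try by move=> *; apply: const.
- by move=> c1 IH1 c2 IH2; apply: add.
- move=> _ c1 IH1 c2 IH2; have [e H] := add _ _ (const 2) (add _ _ IH1 IH2).
  by exists e => B; have := H B; rewrite add2n.
- move=> _ c IH; have [e H] := add _ _ IH (const 5); apply: add (const 3) _.
  by exists e.+1 => B; rewrite expnS; have := H B; nia.
- by move=> _ c IH; apply: add (const 2) IH.
Qed.

Lemma iteri_ind (T : Type) (P : nat -> T -> Prop) k f x :
  P 0 x -> (forall j y, j < k -> P j y -> P j.+1 (f j y)) -> P k (iteri k f x).
Proof.
move=> P0 PS; suff: forall j, j <= k -> P j (iteri j f x) by apply.
by elim=> // j IH ltj; apply: PS => //; apply: IH; apply: ltnW.
Qed.

(* Interleaving the eight arrays with stride 8 gives each of them unbounded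
   length above the fixed registers. *)
Record rep (base d : nat) (rho : nat -> nat) (s : state) (m : memory) : Prop := Rep {
  rep_base : m 2 = base;
  rep_var : forall x, x < 30 -> m (vreg x) = var s x;
  rep_slot : forall k, k < d -> m (sreg k) = rho k;
  rep_arr : forall a i, a < 8 -> m (base + 8 * i + a) = arr s a i }.

Lemma set_regE m d v i : set_reg m d v i = if i == d then v else m i.
Proof. by []. Qed.

Local Ltac reg_neq :=
  rewrite set_regE; case: eqP => [|_]; first by rewrite /vreg /sreg; lia.

Section Simulation.
Variable base : nat.
Hypothesis base_ge : 64 <= base.

Lemma rep_set_tmp d rho s m r v : d <= 30 ->
  r < 2 -> rep base d rho s m -> rep base d rho s (set_reg m r v).
Proof.
move=> dle ltr [R1 R2 R3 R4]; split=> [|x ltx|k ltk|a i lta].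
- by reg_neq.
- by reg_neq; rewrite R2.
- by reg_neq; rewrite R3.
- by reg_neq; rewrite R4.
Qed.

Lemma rep_set_var d rho s m x v : d <= 30 ->
  x < 30 -> rep base d rho s m -> rep base d rho (set_var s x v) (set_reg m (vreg x) v).
Proof.
move=> dle ltx [R1 R2 R3 R4]; split=> [|y lty|k ltk|a i lta].
- by reg_neq.
- rewrite set_regE /= /fupd (_ : (vreg y == vreg x) = (y == x)) ?R2 //.
  by rewrite /vreg; lia.
- by reg_neq; rewrite R3.
- by reg_neq; rewrite R4.
Qed.

Lemma rep_set_slot d rho s m v :
  d < 30 -> rep base d rho s m -> rep base d.+1 (fupd rho d v) s (set_reg m (sreg d) v).
Proof.
move=> ltd [R1 R2 R3 R4]; split=> [|y lty|k ltk|a i lta].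
- by reg_neq.
- by reg_neq; rewrite R2.
- rewrite set_regE /fupd (_ : (sreg k == sreg d) = (k == d)); last by rewrite /sreg; lia.
  by case: eqP => // kd; rewrite R3 //; lia.
- by reg_neq; rewrite R4.
Qed.

Lemma rep_set_arr d rho s m a i v : d <= 30 ->
  a < 8 -> rep base d rho s m ->
  rep base d rho (set_arr s a i v) (set_reg m (base + 8 * i + a) v).
Proof.
move=> dle lta [R1 R2 R3 R4]; split=> [|y lty|k ltk|a' i' lta'].
- by reg_neq.
- by reg_neq; rewrite R2.
- by reg_neq; rewrite R3.
- rewrite /= /fupd; case: (eqVneq a' a) => [->|neqa].
    rewrite set_regE (_ : (_ == _) = (i' == i)) ?R4 //; lia.
  by reg_neq; rewrite R4.
Qed.

Lemma rep_weaken d rho s m j : rep base d.+1 (fupd rho d j) s m -> rep base d rho s m.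
Proof.
case=> R1 R2 R3 R4; split=> // k ltk.
by rewrite R3 ?(leqW ltk) // /fupd ltn_eqF.
Qed.

Lemma ev_addr d rho s m a y : d <= 30 -> a < 8 -> y < 30 -> rep base d rho s m ->
  rep base d rho s (exec_seq (addr_code a y) m) /\
  exec_seq (addr_code a y) m 0 = base + 8 * var s y + a.
Proof.
move=> dle lta lty R; rewrite /exec_seq /=.
split; first by do !(apply: rep_set_tmp => //).
rewrite /set_reg /= (rep_var R lty) (rep_base R); lia.
Qed.

Lemma sreg_tmp k : ((sreg k == 0) = false) * ((sreg k == 1) = false).
Proof. by rewrite /sreg; split; lia. Qed.

Lemma sreg_eq k k' : (sreg k == sreg k') = (k == k').
Proof. by rewrite /sreg; lia. Qed.

(** In a loop the bound sits in an older slot than the counter and slots are never assigned, so the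
    bound is stable; the invariant [loop] adds that register 0 holds the number of passes left. *)
Lemma hcomp_ev c d rho s m B :
  d <= 30 -> wf d c -> (forall k, k < d -> rho k <= B) -> rep base d rho s m ->
  exists k m', [/\ ev (hcomp d c) m k m', k <= time c B
                 & rep base d rho (run d rho c s) m'].
Proof.
elim: c d rho s m => [|x v|x y z|x y z|x a y|a y x|x k|c1 IH1 c2 IH2
  |x c1 IH1 c2 IH2|k c IH|x c IH] d rho s m dle /= Wc rhoB R.
- by exists 0, m; split=> //; constructor.
- exists 1, (exec_seq [:: Const (vreg x) v] m); split=> //; first exact: ev_prims.
  exact: rep_set_var.
- case/and3P: Wc => ltx lty ltz.
  exists 1, (exec_seq [:: Add (vreg x) (vreg y) (vreg z)] m); split=> //; first exact: ev_prims.
  by rewrite /exec_seq /= !(rep_var R) //; apply: rep_set_var.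
- case/and3P: Wc => ltx lty ltz.
  exists 1, (exec_seq [:: Sub (vreg x) (vreg y) (vreg z)] m); split=> //; first exact: ev_prims.
  by rewrite /exec_seq /= !(rep_var R) //; apply: rep_set_var.
- case/and3P: Wc => ltx lta lty; have [R' E] := ev_addr dle lta lty R.
  exists 7, (exec_seq (rcons (addr_code a y) (Fetch (vreg x) 0)) m).
  split=> //; first exact: ev_prims.
  rewrite exec_seq_rcons [exec _ _ _]/= E (rep_arr R' _ lta).
  exact: rep_set_var.
- case/and3P: Wc => ltx lta lty; have [R' E] := ev_addr dle lta lty R.
  exists 7, (exec_seq (rcons (addr_code a y) (Store 0 (vreg x))) m).
  split=> //; first exact: ev_prims.
  rewrite exec_seq_rcons [exec _ _ _]/= E (rep_var R' ltx).
  exact: rep_set_arr.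
- case/andP: Wc => ltx ltk.
  exists 2, (exec_seq [:: Const 0 0; Add (vreg x) (sreg k) 0] m).
  split=> //; first exact: ev_prims.
  rewrite /exec_seq /= !set_regE sreg_tmp (rep_slot R ltk) addn0.
  by apply: rep_set_var => //; apply: rep_set_tmp.
- case/andP: Wc => W1 W2.
  have [k1 [m1 [E1 T1 R1]]] := IH1 _ _ _ _ dle W1 rhoB R.
  have [k2 [m2 [E2 T2 R2]]] := IH2 _ _ _ _ dle W2 rhoB R1.
  exists (k1 + k2), m2; split=> //; first exact: ev_seq E1 E2.
  exact: leq_add.
- case/and3P: Wc => ltx W1 W2; case: eqP => [x0|/eqP xn0].
    have [k2 [m2 [E2 T2 R2]]] := IH2 _ _ _ _ dle W2 rhoB R.
    exists k2.+1, m2; split=> //; last by lia.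
    by apply: ev_if_false => //; rewrite (rep_var R).
  have [k1 [m1 [E1 T1 R1]]] := IH1 _ _ _ _ dle W1 rhoB R.
  exists k1.+2, m1; split=> //; last by lia.
  by apply: ev_if_true => //; rewrite (rep_var R).
- case/and3P: Wc => ltk ltd Wc.
  have rhoB' j : j < rho k -> forall l, l < d.+1 -> fupd rho d j l <= B.
    move=> ltj l ltl; rewrite /fupd; case: eqP => [_|nel].
      by have := rhoB _ ltk; lia.
    by apply: rhoB; lia.
  set f := fun j => run d.+1 (fupd rho d j) c.
  set w := While _ _.
  have loop j m1 : j <= rho k -> rep base d.+1 (fupd rho d j) (iteri j f s) m1 ->
      m1 0 = rho k - j ->
      exists t m2, [/\ ev w m1 t m2, t <= 1 + (rho k - j) * (time c B + 5)
                     & rep base d rho (iteri (rho k) f s) m2].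
    move Er: (rho k - j) => r; elim: r j Er m1 => [|r IHr] j Er m1 lej R1 m10.
      exists 1, m1; split=> //; first exact: ev_while_false.
      have -> : rho k = j by lia.
      exact: rep_weaken R1.
    have ltj: j < rho k by lia.
    have [t1 [m2 [E1 T1 R2]]] := IH d.+1 _ _ _ ltd Wc (rhoB' _ ltj) R1.
    set l := [:: Const 1 1; Add (sreg d) (sreg d) 1; Sub 0 (sreg k) (sreg d)].
    have md : m2 (sreg d) = j by rewrite (rep_slot R2) // /fupd eqxx.
    have R3: rep base d.+1 (fupd rho d j.+1) (iteri j.+1 f s) (exec_seq l m2).
      rewrite /exec_seq /=; apply: rep_set_tmp => //.
      rewrite !set_regE !sreg_tmp md addn1.
      by apply: rep_set_slot => //; apply: rep_set_tmp => //; apply: rep_weaken R2.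
    have m30 : exec_seq l m2 0 = r.
      rewrite /exec_seq /= !set_regE !sreg_tmp !sreg_eq !eqxx /= md.
      rewrite (_ : (k == d) = false); last by lia.
      rewrite (rep_slot R2) ?(leqW ltk) // /fupd ifF; lia.
    have [t2 [m3 [E2 T2 R4]]] := IHr j.+1 ltac:(lia) _ ltj R3 m30.
    exists (t1 + 3 + t2).+2, m3; split=> //; last by lia.
    apply: ev_while_true E2; first by rewrite m10.
    exact: ev_seq E1 (ev_prims (l := l) m2 isT).
  set l0 := [:: Const (sreg d) 0; Sub 0 (sreg k) (sreg d)].
  have R0: rep base d.+1 (fupd rho d 0) (iteri 0 f s) (exec_seq l0 m).
    by apply: rep_set_tmp => //; apply: rep_set_slot.
  have m0: exec_seq l0 m 0 = rho k - 0.
    rewrite /exec_seq /= !set_regE !sreg_eq !eqxx /=.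
    by rewrite (_ : (k == d) = false) ?(rep_slot R) //; lia.
  have [t [m' [E T R']]] := loop 0 _ (leq0n _) R0 m0.
  exists (2 + t), m'; split=> //; first exact: ev_seq (ev_prims (l := l0) m isT) E.
  by have := rhoB _ ltk; nia.
- case/and3P: Wc => ltx /andP[d0 ltd] Wc.
  set l0 := [:: Sub 0 (vreg x) (sreg 0); Sub (sreg d) (vreg x) 0].
  set v := minn (var s x) (rho 0).
  have R0: rep base d.+1 (fupd rho d v) s (exec_seq l0 m).
    rewrite /exec_seq /= !set_regE /=.
    rewrite (rep_var R ltx) (rep_slot R d0).
    rewrite (_ : var s x - (_ - _) = v); last by rewrite /v; lia.
    by apply: rep_set_slot => //; apply: rep_set_tmp => //; apply: ltnW.
  have vB: v <= B by have := rhoB 0 d0; rewrite /v; lia.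
  have [|t [m' [E T R']]] := IH d.+1 _ _ _ ltd Wc _ R0.
    move=> l ltl; rewrite /fupd; case: eqP => [_ //|nel]; apply: rhoB; lia.
  exists (2 + t), m'; split; last exact: rep_weaken R'.
    exact: ev_seq (ev_prims (l := l0) m isT) E.
  by rewrite leq_add2l.
Qed.

End Simulation.

(** Syntactic framing: what a program does not write keeps its value, and the side conditions are
    decided by computation. *)
Fixpoint wvars (c : hcmd) : seq nat :=
  match c with
  | HConst x _ | HAdd x _ _ | HSub x _ _ | HGet x _ _ | HSlot x _ => [:: x]
  | HSkip | HPut _ _ _ => [::]
  | HSeq c1 c2 | HIf _ c1 c2 => wvars c1 ++ wvars c2
  | HFor _ c | HLet _ c => wvars c
  end.

Fixpoint warrs (c : hcmd) : seq nat :=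
  match c with
  | HPut a _ _ => [:: a]
  | HSeq c1 c2 | HIf _ c1 c2 => warrs c1 ++ warrs c2
  | HFor _ c | HLet _ c => warrs c
  | _ => [::]
  end.

Lemma run_var d rho c s x : x \notin wvars c -> var (run d rho c s) x = var s x.
Proof.
elim: c d rho s => [|y v|y a b|y a b|y a b|a b y|y k|c1 IH1 c2 IH2|y c1 IH1 c2 IH2|k c IH|y c IH]
  d rho s //=; rewrite ?inE ?mem_cat ?negb_or /fupd; try by move/negPf->.
- by case/andP=> n1 n2; rewrite IH2 ?IH1.
- by case/andP=> n1 n2; case: ifP => _; rewrite ?IH1 ?IH2.
- move=> nx; apply: (iteri_ind (P := fun _ s' => var s' x = var s x)) => // j s' _ <-.
  exact: IH.
- exact: IH.
Qed.

Lemma run_arr d rho c s a : a \notin warrs c -> arr (run d rho c s) a = arr s a.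
Proof.
elim: c d rho s => [|y v|y b z|y b z|y b z|b y z|y k|c1 IH1 c2 IH2|y c1 IH1 c2 IH2|k c IH|y c IH]
  d rho s //=; rewrite ?inE ?mem_cat ?negb_or /fupd; try by move/negPf->.
- by case/andP=> n1 n2; rewrite IH2 ?IH1.
- by case/andP=> n1 n2; case: ifP => _; rewrite ?IH1 ?IH2.
- move=> nx; apply: (iteri_ind (P := fun _ s' => arr s' a = arr s a)) => // j s' _ <-.
  exact: IH.
- exact: IH.
Qed.

Lemma run_for_ind (P : nat -> state -> Prop) d rho k c s :
  P 0 s ->
  (forall j s', j < rho k -> P j s' -> P j.+1 (run d.+1 (fupd rho d j) c s')) ->
  P (rho k) (run d rho (HFor k c) s).
Proof. exact: iteri_ind. Qed.

Lemma run_seq d rho c1 c2 s : run d rho (HSeq c1 c2) s = run d rho c2 (run d rho c1 s).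
Proof. by []. Qed.

Definition hblk (l : seq hcmd) : hcmd := foldr HSeq HSkip l.

Lemma run_blk d rho c l s : run d rho (hblk (c :: l)) s = run d rho (hblk l) (run d rho c s).
Proof. by []. Qed.

Lemma run_nil d rho s : run d rho (hblk [::]) s = s.
Proof. by []. Qed.

(** * Cuts in the double cover *)

(** All capacities are 1 and parallel arcs are allowed, so reversing an arc in place pushes a unit
    of flow through it: the two arrays always hold the residual graph. *)
Definition out (M : nat) (tl hd : nat -> nat) (S : pred nat) : nat :=
  \sum_(j < M) (S (tl j) && ~~ S (hd j)).

Lemma sum_fupd M (F G : nat -> nat) j : j < M ->
  (forall i, i != j -> F i = G i) ->
  \sum_(i < M) F i + G j = \sum_(i < M) G i + F j.
Proof.
move=> ltj FG; rewrite (bigD1 (Ordinal ltj)) //= [in RHS](bigD1 (Ordinal ltj)) //=.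
rewrite (eq_bigr (fun i : 'I_M => G i)); first by lia.
by move=> i nei; apply: FG; apply: contra nei => /eqP ij; apply/eqP/val_inj.
Qed.

Lemma out_swap M tl hd S j : j < M ->
  out M (fupd tl j (hd j)) (fupd hd j (tl j)) S + S (tl j) =
  out M tl hd S + S (hd j).
Proof.
move=> ltj.
pose F i : nat := S (fupd tl j (hd j) i) && ~~ S (fupd hd j (tl j) i).
pose G i : nat := S (tl i) && ~~ S (hd i).
have FG i : i != j -> F i = G i by move=> /negPf nij; rewrite /F /G /fupd nij.
have := sum_fupd ltj FG; rewrite -[\sum_(i < M) G i]/(out M tl hd S).
rewrite -[\sum_(i < M) F i]/(out M (fupd tl j (hd j)) (fupd hd j (tl j)) S).
rewrite (_ : F j = S (hd j) && ~~ S (tl j)); last by rewrite /F /fupd eqxx.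
by rewrite /G; case: (S (tl j)); case: (S (hd j)) => /=; lia.
Qed.

Lemma out_leq M tl hd S : out M tl hd S <= M.
Proof.
rewrite -[X in _ <= X](card_ord M) -sum1_card; apply: leq_sum => j _; exact: leq_b1.
Qed.

Lemma out0P M tl hd (S : pred nat) :
  (forall j, j < M -> S (tl j) -> S (hd j)) -> out M tl hd S = 0.
Proof.
move=> closed; apply: big1 => j _; have := closed _ (ltn_ord j).
by case: (S (tl j)) => // ->.
Qed.

Definition cnt (N : nat) (f : nat -> nat) : nat := \sum_(y < N) (f y != 0).

Lemma cnt_leq N f : cnt N f <= N.
Proof.
rewrite -[X in _ <= X](card_ord N) -sum1_card; apply: leq_sum => j _; exact: leq_b1.
Qed.

Lemma cnt_fupd N f y : y < N -> f y = 0 -> cnt N (fupd f y 1) = (cnt N f).+1.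
Proof.
move=> lty fy.
have := @sum_fupd N (fun i => fupd f y 1 i != 0 : nat) (fun i => f i != 0 : nat) y lty.
rewrite /fupd eqxx fy /= addn0 addn1; apply=> i /negPf -> //.
Qed.

Lemma cnt_full N f y : N <= cnt N f -> y < N -> f y != 0.
Proof.
move=> leN lty; case: eqP => // fy.
by have := cnt_leq N (fupd f y 1); rewrite cnt_fupd // ltnNge leN.
Qed.

Section DoubleCover.
Variables (n m : nat) (uu ww : nat -> nat).

Definition unc (z : pred nat) : nat := \sum_(e < m) (z (uu e) == z (ww e)).

Definition optimal (z : pred nat) : Prop := forall z', unc z <= unc z'.

(* Node [v] of the double cover says that [v] lies in the set, node [n + v] that
   it does not; an edge [uv] becomes [u -- n + v] and [n + u -- v], in both
   directions. *)
Definition is_cover (tl hd : nat -> nat) : Prop := forall e, e < m ->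
  [/\ tl (4 * e) = uu e /\ hd (4 * e) = ww e + n,
      tl (4 * e + 1) = ww e + n /\ hd (4 * e + 1) = uu e,
      tl (4 * e + 2) = uu e + n /\ hd (4 * e + 2) = ww e
    & tl (4 * e + 3) = ww e /\ hd (4 * e + 3) = uu e + n].

Lemma sum_quad (F : nat -> nat) k :
  \sum_(j < 4 * k) F j =
  \sum_(e < k) (F (4 * e) + F (4 * e + 1) + F (4 * e + 2) + F (4 * e + 3)).
Proof.
elim: k => [|k IH]; first by rewrite muln0 !big_ord0.
by rewrite [in LHS]mulnS addnC addn4 !big_ord_recr /= IH !addnA !addn1 !addn2 !addn3.
Qed.

Lemma out_cover tl hd S : is_cover tl hd ->
  out (4 * m) tl hd S =
  \sum_(e < m) ((S (uu e) != S (ww e + n)) + (S (uu e + n) != S (ww e))).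
Proof.
move=> C; rewrite /out (sum_quad (fun j => S (tl j) && ~~ S (hd j) : nat)); apply: eq_bigr => e _.
have [[-> ->] [-> ->] [-> ->] [-> ->]] := C e (ltn_ord e).
by do 4 case: (S _).
Qed.

Definition node (z : pred nat) : pred nat := fun y => if y < n then z y else ~~ z (y - n).

Lemma nodeN z v : node z (v + n) = ~~ z v.
Proof. by rewrite /node ltnNge leq_addl /= addnK. Qed.

Hypothesis uu_lt : forall e, e < m -> uu e < n.
Hypothesis ww_lt : forall e, e < m -> ww e < n.

Lemma out_node tl hd z : is_cover tl hd -> out (4 * m) tl hd (node z) = 2 * unc z.
Proof.
move=> C; rewrite (out_cover _ C) /unc big_distrr; apply: eq_bigr => e _ /=.
rewrite !nodeN /node uu_lt ?ww_lt //.
by case: (z _); case: (z _).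
Qed.

(** One array encodes both kinds of terminals: a marked node is a source and its mate a sink. If
    both mates are marked no set is valid. *)
Definition valid (src : nat -> nat) (S : pred nat) : Prop := forall v, v < n ->
  (src v != 0 -> S v && ~~ S (v + n)) /\ (src (v + n) != 0 -> S (v + n) && ~~ S v).

Variables (b t : nat) (col : pred nat).
Hypothesis good_edge : forall e, e < m ->
  [|| col (uu e) != col (ww e), uu e \in [:: b; t] | ww e \in [:: b; t]].

(* The double cover of the bipartite part has two components; a minimum cut of
   the whole, read on one component or on the other, gives two assignments whose
   costs add up to its capacity, hence both are optimal. *)
Lemma min_cut_optimal tl hd src (R : pred nat) z v :
  is_cover tl hd -> b < n -> t < n ->
  (src b != 0) || (src (b + n) != 0) -> (src t != 0) || (src (t + n) != 0) ->
  optimal z -> valid src (node z) -> valid src R ->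
  (forall S, valid src S -> out (4 * m) tl hd R <= out (4 * m) tl hd S) ->
  v < n ->
  exists z', [/\ optimal z', valid src (node z') & z' v = ~~ R (v + n)].
Proof.
move=> C ltb ltt fb ft oz vz vR minR ltv.
(* One component of the cover consists of the nodes [u] with [col u = c] and the mates of the other
   vertices; [zc c] reads [R] there. *)
pose zc (c : bool) : pred nat := fun u => if col u == c then R u else ~~ R (u + n).
have fixed u : u < n -> (src u != 0) || (src (u + n) != 0) -> R (u + n) = ~~ R u.
  move=> ltu; have [H1 H2] := vR u ltu.
  by case/orP=> [/H1|/H2] /andP[-> /negPf->].
have fixed_bt u : u \in [:: b; t] -> R (u + n) = ~~ R u.
  by rewrite !inE => /orP[] /eqP ->; apply: fixed.
(* An edge between colours has one copy in each component. At an end equal to [b] or [t] the set [R]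
   is consistent, so both readings agree there and the two copies can again be shared out. *)
have sumR: out (4 * m) tl hd R = unc (zc true) + unc (zc false).
  rewrite (out_cover _ C) /unc -big_split; apply: eq_bigr => e _ /=.
  rewrite /zc; case/or3P: (good_edge (ltn_ord e)) => [ne|/fixed_bt ->|/fixed_bt ->].
  - by move: ne; case: (col _); case: (col _) => //= _; do 4 case: (R _).
  - by case: (col _); case: (col _) => /=; do 3 case: (R _).
  - by case: (col _); case: (col _) => /=; do 3 case: (R _).
(* The node set of [z] is valid, so the two costs add up to at most twice the optimum. *)
have ozc c : optimal (zc c).
  have := minR _ vz; rewrite sumR out_node //.
  have := oz (zc true); have := oz (zc false); move=> h1 h2 h3 z'.
  by have := oz z'; case: c; lia.
(* The component that contains the mate [v + n], the node inspected by the algorithm. *)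
exists (zc (~~ col v)); split=> // [u ltu|]; last by rewrite /zc; case: (col v).
have [H1 H2] := vR u ltu; rewrite !nodeN /node ltu /zc.
split=> [/H1|/H2] /andP[]; do 2 case: (R _) => //; by case: ifP.
Qed.

End DoubleCover.

(** * The algorithm *)

Local Notation aword := 0.
Local Notation abest := 1.
Local Notation atl := 2.
Local Notation ahd := 3.
Local Notation asrc := 4.
Local Notation areach := 5.
Local Notation apar := 6.

Local Notation vn := 0.
Local Notation vone := 1.
Local Notation vz := 2.
Local Notation vbest := 3.
Local Notation vcost := 4.
Local Notation vfound := 5.
Local Notation vx := 6.
Local Notation vj := 7.
Local Notation va := 8.
Local Notation vc := 9.
Local Notation vp := 10.
Local Notation vq := 11.
Local Notation vu := 12.
Local Notation vw := 13.
Local Notation vy := 14.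
Local Notation vv := 15.
Local Notation vm := 16.
Local Notation vN := 17.
Local Notation vM := 18.

(** Slots 0 to 4 hold the array base, [n], [2n], [m] and [4m]; slots 5 and 6 the guessed nodes, slot
    7 the current vertex, node or edge, slot 8 the augmentation round, slot 9 a labelling pass, walk
    step, node or vertex, and slot 10 an arc. *)
Definition copy_src : hcmd :=
  hblk [:: HSlot vy 9; HGet vp asrc vy; HPut areach vy vp].

Definition label_arc : hcmd :=
  hblk [:: HSlot vj 10; HGet va atl vj; HGet vc ahd vj; HGet vp areach va;
    HIf vp (hblk [:: HGet vq areach vc;
      HIf vq HSkip (hblk [:: HPut areach vc vone; HPut apar vc vj])]) HSkip].

(** Reachability by repeated sweeps over the arc list, which needs no queue. *)
Definition label : hcmd :=
  HSeq (HFor 2 copy_src) (HFor 2 (HFor 4 label_arc)).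

Definition probe (x y : nat) : hcmd :=
  hblk [:: HGet vp areach x; HGet vq asrc y;
    HIf vp (HIf vq (hblk [:: HAdd vx x vz; HConst vfound 1]) HSkip) HSkip].

Definition find_sink : hcmd :=
  hblk [:: HSlot vv 9; HAdd vy vv vn; probe vv vy; probe vy vv].

Definition walk_back : hcmd :=
  hblk [:: HGet vp asrc vx;
    HIf vp HSkip (hblk [:: HGet vj apar vx; HGet vy atl vj; HGet vc ahd vj;
      HPut atl vj vc; HPut ahd vj vy; HAdd vx vy vz])].

Definition augment : hcmd :=
  hblk [:: label; HConst vfound 0; HFor 1 find_sink;
    HIf vfound (HFor 2 walk_back) HSkip].

Definition load_edge : hcmd :=
  hblk [:: HSlot vj 7; HAdd vj vj vj; HAdd va vj vone; HGet vu aword va;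
    HAdd va va vone; HGet vw aword va].

Definition put_arc (x y : nat) : hcmd :=
  hblk [:: HPut atl vj x; HPut ahd vj y; HAdd vj vj vone].

Definition load_arcs : hcmd :=
  hblk [:: load_edge; HAdd va vu vn; HAdd vc vw vn; HAdd vj vj vj;
    put_arc vu vc; put_arc vc vu; put_arc va vw; put_arc vw va].

Definition fix_vertex : hcmd :=
  hblk [:: HFor 0 augment; HSlot vv 7; HAdd vy vv vn; HGet vp areach vy;
    HIf vp (HPut asrc vy vone) (HPut asrc vv vone)].

Definition count_edge : hcmd :=
  hblk [:: load_edge; HGet vp asrc vu; HGet vq asrc vw;
    HIf vp (HIf vq (HAdd vcost vcost vone) HSkip)
           (HIf vq HSkip (HAdd vcost vcost vone))].

Definition save_vertex : hcmd :=
  hblk [:: HSlot vv 7; HGet vp asrc vv;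
    HIf vp (HPut abest vv vone) (HPut abest vv vz)].

Definition solve_pair : hcmd :=
  hblk [:: HFor 2 (hblk [:: HSlot vy 7; HPut asrc vy vz]);
    HFor 3 load_arcs;
    HSlot vy 5; HPut asrc vy vone; HSlot vy 6; HPut asrc vy vone;
    HFor 1 fix_vertex].

Definition record_best : hcmd :=
  hblk [:: HConst vcost 0; HFor 3 count_edge; HSub vp vbest vcost;
    HIf vp (hblk [:: HAdd vbest vcost vz; HFor 1 save_vertex]) HSkip].

Definition search : hcmd := HFor 2 (HFor 2 (HSeq solve_pair record_best)).

(* The register holding the array base, here slot 0, is [64 * (2 * m + 1 + n)]. *)
Definition setup : hcmd :=
  hblk [:: HConst vz 0; HConst vone 1; HGet vn aword vz; HAdd vN vn vn;
    HSlot vy 0; HAdd vp vN vN; HAdd vp vp vp; HAdd vp vp vp; HAdd vp vp vp;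
    HAdd vp vp vp; HSub vy vy vp; HConst vp 64; HSub vy vy vp;
    HConst vp 128; HConst vm 0].

(** [m] is recovered from the array base by repeated subtraction of 128. [vbest] starts at [m + 1],
    above every cost. The caps in [HLet] change nothing, as slot 0 exceeds all four values. *)
Definition main : hcmd :=
  hblk [:: setup;
    HFor 0 (HIf vy (hblk [:: HSub vy vy vp; HAdd vm vm vone]) HSkip);
    HAdd vM vm vm; HAdd vM vM vM; HAdd vbest vm vone;
    HLet vn (HLet vN (HLet vm (HLet vM search)))].

Lemma main_wf : wf 1 main.
Proof. by []. Qed.

(** * Invariants of the labelling *)

Definition parent_ok N M tl hd reach par (rk : nat -> nat) y : Prop :=
  [/\ par y < M, hd (par y) = y, tl (par y) < N, reach (tl (par y)) != 0
    & rk (tl (par y)) < rk y].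

(* [rk] is a ghost: the stage at which a node is labelled. It decreases along
   parents, so that walking back from a labelled node ends in a source. *)
Definition forest N M (src tl hd reach par rk : nat -> nat) : Prop :=
  (forall y, y < N -> src y != 0 -> reach y != 0) /\
  (forall y, y < N -> reach y != 0 -> rk y <= cnt N reach /\
     (src y != 0 \/ parent_ok N M tl hd reach par rk y)).

(** Ranks in use are at most the number of labelled nodes, so the new node gets a larger one. It was
    unlabelled, hence the tail of no parent arc, and the old parents survive. *)
Lemma forest_add N M src tl hd reach par rk j :
  forest N M src tl hd reach par rk -> j < M -> tl j < N -> hd j < N ->
  reach (tl j) != 0 -> reach (hd j) = 0 ->
  forest N M src tl hd (fupd reach (hd j) 1) (fupd par (hd j) j)
    (fupd rk (hd j) (cnt N reach).+1).
Proof.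
move=> [F1 F2] ltj ltt lth rt rh; split=> y lty.
  by move=> sy; rewrite /fupd; case: ifP => // _; apply: F1.
rewrite cnt_fupd // /fupd; case: (eqVneq y (hd j)) => [->|ney] ry.
  split=> //; right; rewrite /parent_ok !eqxx; split=> //.
    by case: ifP.
  have ->: (tl j == hd j) = false by apply/eqP => E; rewrite E rh in rt.
  by rewrite ltnS; case: (F2 _ ltt rt).
have [le1 H] := F2 y lty ry; split; first exact: leqW.
case: H => [|[P1 P2 P3 P4 P5]]; [by left | right].
rewrite /parent_ok (negPf ney); split=> //.
  by case: ifP.
have ->: (tl (par y) == hd j) = false by apply/eqP => E; rewrite E rh in P4.
done.
Qed.

Definition closed M (tl hd reach : nat -> nat) : Prop :=
  forall j, j < M -> reach (tl j) != 0 -> reach (hd j) != 0.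

Definition arcs_in N M (tl hd : nat -> nat) : Prop :=
  forall j, j < M -> (tl j < N) && (hd j < N).

(** These three variables serve as constants; a variable is copied by adding [vz]. *)
Definition konst n (s : state) : Prop :=
  [/\ var s vn = n, var s vone = 1 & var s vz = 0].

Lemma run_konst n d rho c s :
  ~~ has (mem (wvars c)) [:: vn; vone; vz] -> konst n s -> konst n (run d rho c s).
Proof.
by rewrite /= !negb_or => /and4P[n1 n2 n3 _] [k1 k2 k3]; split; rewrite run_var.
Qed.

Section Run.
Variables (base n m : nat).
Hypothesis base_big : 4 * m < base.

Local Notation N := (n + n).
Local Notation M := (4 * m).

Definition env (rho : nat -> nat) : Prop :=
  [/\ rho 0 = base, rho 1 = n, rho 2 = N, rho 3 = m & rho 4 = M].

Lemma env_fupd rho d j : 4 < d -> env rho -> env (fupd rho d j).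
Proof. by case: d => [|[|[|[|[|d]]]]]. Qed.

Lemma run_copy_src rho s : env rho ->
  forall y, y < N -> arr (run 9 rho (HFor 2 copy_src) s) areach y = arr s asrc y.
Proof.
case=> _ _ e2 _ _.
suff: arr (run 9 rho (HFor 2 copy_src) s) asrc = arr s asrc /\
  forall y, y < rho 2 -> arr (run 9 rho (HFor 2 copy_src) s) areach y = arr s asrc y.
  by rewrite e2 => -[].
apply: (run_for_ind (P := fun k s' => arr s' asrc = arr s asrc /\
  forall y, y < k -> arr s' areach y = arr s asrc y)) => // j s1 ltj [E H].
rewrite /= /fupd /= E; split=> // y; rewrite ltnS leq_eqVlt.
by case: (eqVneq y j) => [->|_] //= /H.
Qed.

Lemma run_label_arc rho s j : konst n s ->
  let s' := run 11 (fupd rho 10 j) label_arc s in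
  let R := arr s areach in let a := arr s atl j in let c := arr s ahd j in
  (arr s' areach = if (R a != 0) && (R c == 0) then fupd R c 1 else R) /\
  (arr s' apar = if (R a != 0) && (R c == 0) then fupd (arr s apar) c j else arr s apar).
Proof.
move=> [_ k1 _] /=; rewrite /fupd /=.
by case: ifP => //= _; case: ifP => //= _; rewrite /fupd /= k1.
Qed.

(** A pass that labels nothing has tested every arc against the same set, so that set is closed.
    Recording that a growing set was not closed before lets the caller exclude growth after
    closure. *)
Lemma run_label_pass rho s rk :
  let tl := arr s atl in let hd := arr s ahd in let src := arr s asrc in
  env rho -> konst n s -> arcs_in N M tl hd ->
  forest N M src tl hd (arr s areach) (arr s apar) rk ->
  let s' := run 10 rho (HFor 4 label_arc) s in
  (exists rk', forest N M src tl hd (arr s' areach) (arr s' apar) rk') /\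
  (closed M tl hd (arr s' areach) \/
   ~ closed M tl hd (arr s areach) /\ cnt N (arr s areach) < cnt N (arr s' areach)).
Proof.
move=> tl hd src [_ _ _ _ e4] ks arcs F0 s'.
pose P k s1 := [/\ konst n s1, [/\ arr s1 atl = tl, arr s1 ahd = hd & arr s1 asrc = src],
  exists rk', forest N M src tl hd (arr s1 areach) (arr s1 apar) rk' &
  (arr s1 areach = arr s areach /\
     forall j, j < k -> arr s1 areach (tl j) != 0 -> arr s1 areach (hd j) != 0)
  \/ ~ closed M tl hd (arr s areach) /\ cnt N (arr s areach) < cnt N (arr s1 areach)].
suff: P (rho 4) s'.
  rewrite e4; case=> _ _ H1 H2; split=> //; case: H2 => [[_ H2]|H2]; [left|by right].
  by move=> j; apply: H2.
apply: run_for_ind; first by split=> //; [exists rk | left].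
move=> j s1; rewrite e4 => ltj [k1 [E1 E2 E3] [rk' F1] H1].
have [R1 R2] := run_label_arc rho j k1.
split; first exact: run_konst.
- by rewrite !run_arr.
- rewrite R1 R2 E1 E2; case: ifP => [/andP[ra /eqP rc]|_]; last by exists rk'.
  exists (fupd rk' (hd j) (cnt N (arr s1 areach)).+1).
  by case/andP: (arcs j ltj) => *; apply: forest_add.
rewrite R1 E1 E2; case: ifP => [/andP[ra /eqP rc]|nadd].
  right; case/andP: (arcs j ltj) => _ lth; rewrite cnt_fupd //.
  case: H1 => [[E _]|[H1 H2]]; last by split=> //; apply: leqW.
  by rewrite -E; split=> // H; have := H j ltj ra; rewrite rc.
case: H1 => [[E H1]|H1]; [left; split=> // i | by right].
rewrite ltnS leq_eqVlt; case/orP=> [/eqP ->|]; last exact: H1.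
by move=> ra; move: nadd; rewrite ra /= => ->.
Qed.

Lemma run_label rho s :
  let tl := arr s atl in let hd := arr s ahd in let src := arr s asrc in
  konst n s -> env rho -> arcs_in N M tl hd ->
  let s' := run 9 rho label s in
  (exists rk, forest N M src tl hd (arr s' areach) (arr s' apar) rk) /\
  closed M tl hd (arr s' areach).
Proof.
move=> tl hd src ks erho arcs s'; rewrite /s' /label run_seq {s'}.
have := run_copy_src s erho.
set s1 := run 9 rho _ s => copied.
have k1 : konst n s1 by apply: run_konst.
have [Et Eh Es]: [/\ arr s1 atl = tl, arr s1 ahd = hd & arr s1 asrc = src].
  by split; apply: run_arr.
set s' := run _ _ _ _.
pose P k s2 := [/\ konst n s2, [/\ arr s2 atl = tl, arr s2 ahd = hd & arr s2 asrc = src],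
  exists rk', forest N M src tl hd (arr s2 areach) (arr s2 apar) rk' &
  closed M tl hd (arr s2 areach) \/ k <= cnt N (arr s2 areach)].
have e2 : rho 2 = N by case: erho.
(* Without closure each pass adds a node, so after [2n] passes all [2n] nodes are labelled, and the
   full set is closed. *)
suff: P (rho 2) s'.
  case=> _ _ H1 H2; split=> //; case: H2 => //; rewrite e2 => leN j ltj _.
  by apply: cnt_full leN _; case/andP: (arcs j ltj).
apply: run_for_ind.
  split=> //; last by right.
  exists (fun _ => 0); split=> y lty; rewrite copied //.
  by move=> sy; split=> //; left.
move=> p s2 ltp [k2 [E2 E3 E4] [rk F2] H2].
have arcs2: arcs_in N M (arr s2 atl) (arr s2 ahd) by rewrite E2 E3.
rewrite -E2 -E3 -E4 in F2.
have := run_label_pass (env_fupd p (d := 9) isT erho) k2 arcs2 F2; cbv zeta.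
set s3 := run _ _ _ _.
rewrite E2 E3 E4 => -[H3 H4]; split=> //.
- exact: run_konst.
- by rewrite !run_arr.
- case: H4 => [|[nc lt]]; [by left | right].
  by case: H2 => // le; apply: leq_ltn_trans le lt.
Qed.

(** * Augmenting walks and minimum cuts *)

Definition sink (src : nat -> nat) (x : nat) : Prop :=
  exists2 v, v < n & (x = v /\ src (v + n) != 0) \/ (x = v + n /\ src v != 0).

Lemma run_probe d rho s x y : konst n s -> x > vq -> y > vq ->
  let s' := run d rho (probe x y) s in
  let h := (arr s areach (var s x) != 0) && (arr s asrc (var s y) != 0) in
  var s' vfound = (if h then 1 else var s vfound) /\
  var s' vx = (if h then var s x else var s vx).
Proof.
move=> [_ _ kz] ltx lty; cbv zeta.
have nx k : k <= vq -> (x == k) = false by lia.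
have ny k : k <= vq -> (y == k) = false by lia.
case r: (arr s areach (var s x) == 0); case q: (arr s asrc (var s y) == 0);
by do 2 rewrite /= /fupd /= ?nx ?ny // ?r ?q ?kz ?addn0.
Qed.

Lemma run_find_sink1 rho s v : konst n s ->
  let s' := run 10 (fupd rho 9 v) find_sink s in
  let src := arr s asrc in let reach := arr s areach in
  let h1 := (reach v != 0) && (src (v + n) != 0) in
  let h2 := (reach (v + n) != 0) && (src v != 0) in
  var s' vfound = (if h1 || h2 then 1 else var s vfound) /\
  var s' vx = (if h2 then v + n else if h1 then v else var s vx).
Proof.
move=> ks; have [kn _ _] := ks; rewrite /find_sink; do 2 rewrite run_blk.
set s1 := run _ _ _ (run _ _ _ s).
have k1 : konst n s1 by apply: run_konst.
have E1 : arr s1 = arr s by [].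
have [V1 V2 V3 V4] : [/\ var s1 vv = v, var s1 vy = v + n,
    var s1 vfound = var s vfound & var s1 vx = var s vx].
  by rewrite /s1 /= /fupd /= kn.
clearbody s1; rewrite run_blk.
have [F2 X2] := run_probe 10 (fupd rho 9 v) (x := vv) (y := vy) k1 isT isT.
set s2 := run _ _ _ s1 in F2 X2 *.
have k2 : konst n s2 by apply: run_konst.
have [E2 E3] : arr s2 areach = arr s1 areach /\ arr s2 asrc = arr s1 asrc.
  by rewrite !run_arr.
have [V5 V6] : var s2 vv = v /\ var s2 vy = v + n by rewrite !run_var.
clearbody s2; rewrite run_blk run_nil.
have [F3 X3] := run_probe 10 (fupd rho 9 v) (x := vy) (y := vv) k2 isT isT.
rewrite {}F3 {}X3 F2 X2 V5 V6 E2 E3 V1 V2 V3 V4 E1.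
by case: (_ && _); case: (_ && _).
Qed.

Lemma run_find_sink rho s : env rho -> konst n s -> var s vfound = 0 ->
  let src := arr s asrc in let reach := arr s areach in
  let s' := run 9 rho (HFor 1 find_sink) s in
  if var s' vfound == 0 then forall x, sink src x -> reach x = 0
  else [/\ var s' vx < N, reach (var s' vx) != 0 & sink src (var s' vx)].
Proof.
move=> [_ e1 _ _ _] ks f0 src reach s'.
pose P k s1 := [/\ konst n s1, arr s1 asrc = src, arr s1 areach = reach &
  if var s1 vfound == 0 then forall v, v < k ->
    (src (v + n) != 0 -> reach v = 0) /\ (src v != 0 -> reach (v + n) = 0)
  else [/\ var s1 vx < N, reach (var s1 vx) != 0 & sink src (var s1 vx)]].
suff: P (rho 1) s'.
  rewrite e1; case=> _ _ _; case: ifP => // _ H x [v ltv].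
  by have [H1 H2] := H v ltv; case=> -[-> sv]; [apply: H1 | apply: H2].
apply: run_for_ind; first by split; rewrite ?f0.
move=> v s1; rewrite e1 => ltv [k1 E1 E2 H1].
split; [exact: run_konst | by rewrite run_arr | by rewrite run_arr | ].
have [kn _ kz] := k1; rewrite -E1 -E2 in H1 *.
have sv1 : arr s1 asrc (v + n) != 0 -> sink (arr s1 asrc) v by exists v => //; left.
have sv2 : arr s1 asrc v != 0 -> sink (arr s1 asrc) (v + n) by exists v => //; right.
have [-> ->] := run_find_sink1 rho v k1.
case h: (_ || _) => /=.
  case: ifP h => [/andP[r2 q2] _|_]; first by split=> //; [lia | exact: sv2].
  by rewrite orbF => h; rewrite h; case/andP: h => r1 q1; split=> //; [lia | exact: sv1].
have /norP[h1 h2] := negbT h; rewrite (negPf h1) (negPf h2); case: ifP H1 => // _ H1 w.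
rewrite ltnS leq_eqVlt => /orP[/eqP ->|/H1 //].
move: h1 h2; rewrite !negb_and !negbK => h1 h2.
by split=> q; apply/eqP; [case/orP: h1 => // /eqP E; rewrite E in q
                        | case/orP: h2 => // /eqP E; rewrite E in q].
Qed.

Lemma run_walk_back1 d rho s : konst n s ->
  let x := var s vx in let j := arr s apar x in
  let s' := run d rho walk_back s in
  if arr s asrc x == 0 then
    [/\ arr s' atl = fupd (arr s atl) j (arr s ahd j),
        arr s' ahd = fupd (arr s ahd) j (arr s atl j) & var s' vx = arr s atl j]
  else [/\ arr s' atl = arr s atl, arr s' ahd = arr s ahd & var s' vx = x].
Proof.
move=> [_ _ kz]; cbv zeta; case h: (arr s asrc (var s vx) == 0);
by do 2 (rewrite /= /fupd /= ?h ?kz ?addn0).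
Qed.

(* Reversing an arc of head [x] and tail [y] changes the out-degree of [S] by
   [x \in S] minus [y \in S], so the changes telescope along the walk. *)
Lemma run_walk rho s rk :
  let tl := arr s atl in let hd := arr s ahd in let src := arr s asrc in
  let reach := arr s areach in let x := var s vx in
  env rho -> konst n s -> arcs_in N M tl hd ->
  forest N M src tl hd reach (arr s apar) rk ->
  x < N -> reach x != 0 ->
  let s' := run 9 rho (HFor 2 walk_back) s in
  [/\ arcs_in N M (arr s' atl) (arr s' ahd), var s' vx < N, src (var s' vx) != 0
    & forall S : pred nat, out M (arr s' atl) (arr s' ahd) S + S (var s' vx) =
        out M tl hd S + S x].
Proof.
move=> tl hd src reach x [_ _ e2 _ _] ks arcs [_ F] ltx rx s'.
set par := arr s apar in F.
pose P k s1 := let y := var s1 vx in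
  [/\ konst n s1, [/\ arr s1 asrc = src & arr s1 apar = par],
  [/\ arcs_in N M (arr s1 atl) (arr s1 ahd), y < N, reach y != 0
    & src y != 0 \/ rk y + k <= N],
  forall z, z < N -> reach z != 0 -> src z = 0 -> rk z <= rk y ->
    parent_ok N M (arr s1 atl) (arr s1 ahd) reach par rk z
  & forall S : pred nat, out M (arr s1 atl) (arr s1 ahd) S + S y = out M tl hd S + S x].
suff: P (rho 2) s'.
  rewrite e2; case=> _ _ [A1 A2 A3 A4] A5 A6; split=> //.
  (* An unmarked node after [2n] steps would have rank 0, yet its parent would have a smaller
     rank. *)
  case: A4 => //; case: (eqVneq (src (var s' vx)) 0) => // sx le.
  by have [_ _ _ _] := A5 _ A2 A3 sx (leqnn _); lia.
apply: run_for_ind.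
  split=> //.
    by split=> //; right; have [le _] := F x ltx rx; rewrite addn0 (leq_trans le (cnt_leq _ _)).
  by move=> z ltz rz sz _; have [_ []] := F z ltz rz; rewrite ?sz.
move=> i s1 _ [k1 [E1 E2] [A1 A2 A3 A4] A5 A6].
have := run_walk_back1 10 (fupd rho 9 i) k1; cbv zeta.
set s2 := run _ _ _ _; rewrite E1 E2; set y := var s1 vx in A2 A3 A4 A5 A6 *.
have k2 : konst n s2 by apply: run_konst.
have [E3 E4] : [/\ arr s2 asrc = src & arr s2 apar = par] by rewrite !run_arr.
case: (eqVneq (src y) 0) => [sy|sy] [B1 B2 B3]; last first.
  by rewrite /P B1 B2 B3 -/y; split=> //; split=> //; left.
have [Q1 Q2 Q3 Q4 Q5] := A5 y A2 A3 sy (leqnn _).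
set tl1 := arr s1 atl in B1 B2 B3 A1 A5 A6 Q1 Q2 Q3 Q4 Q5 *.
set hd1 := arr s1 ahd in B1 B2 A1 A5 A6 Q1 Q2 Q3 Q4 Q5 *.
rewrite /P B1 B2 B3; split=> //.
- split=> //.
    move=> j ltj; rewrite /fupd; case: eqP => [_|_]; last exact: A1.
    by rewrite Q3 Q2 A2.
  by right; case: A4 => [|A4]; [rewrite sy | lia].
- move=> z ltz rz sz lez.
  have [C1 C2 C3 C4 C5] := A5 z ltz rz sz ltac:(lia).
  have nezy : z != y by apply/eqP => E; rewrite E in lez; lia.
  (* A parent arc has its own node as head, so distinct nodes have distinct parent arcs, and only
     that of [y] was reversed. *)
  have nep : (par z == par y) = false.
    by apply/eqP => E; rewrite -C2 -Q2 E eqxx in nezy.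
  by rewrite /parent_ok /fupd nep.
- move=> S; have := out_swap tl1 hd1 S Q1; rewrite Q2 => ->.
  exact: A6.
Qed.

(** A valid set contains the source where the walk ends and misses the sink where it starts, so the
    balance of the walk is exactly one. If no sink is labelled, the labelled set is itself valid and
    no arc leaves it. *)
Lemma run_augment rho s :
  let tl := arr s atl in let hd := arr s ahd in let src := arr s asrc in
  env rho -> konst n s -> arcs_in N M tl hd ->
  let s' := run 9 rho augment s in
  arcs_in N M (arr s' atl) (arr s' ahd) /\
  if var s' vfound == 0 then
    let R : pred nat := fun y => arr s' areach y != 0 in
    valid n src R /\ out M (arr s' atl) (arr s' ahd) R = 0 /\
    forall S, out M (arr s' atl) (arr s' ahd) S = out M tl hd S
  else forall S, valid n src S ->
    out M (arr s' atl) (arr s' ahd) S + 1 = out M tl hd S.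
Proof.
move=> tl hd src erho ks arcs s'.
have := run_label ks erho arcs; cbv zeta.
set s1 := run 9 rho label s => -[[rk F] C].
have k1 : konst n s1 by apply: run_konst.
have [E1 E2 E3]: [/\ arr s1 atl = tl, arr s1 ahd = hd & arr s1 asrc = src].
  by split; apply: run_arr.
pose s2 := run 9 rho (HConst vfound 0) s1.
have k2 : konst n s2 by apply: run_konst.
have Ea : arr s2 = arr s1 by [].
have := run_find_sink erho k2 erefl; cbv zeta.
set s3 := run 9 rho _ s2; rewrite Ea E3 => H3.
have k3 : konst n s3 by apply: run_konst.
have E4 a : arr s3 a = arr s1 a by rewrite run_arr.
have Es' : s' = if var s3 vfound == 0 then s3 else run 9 rho (HFor 2 walk_back) s3 by [].
have src_eq v : v < n -> forall S, valid n src S -> src v != 0 -> S v.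
  by move=> ltv S /(_ v ltv)[H _] /H /andP[].
have srcN_eq v : v < n -> forall S, valid n src S -> src (v + n) != 0 -> S (v + n).
  by move=> ltv S /(_ v ltv)[_ H] /H /andP[].
case: (eqVneq (var s3 vfound) 0) H3 Es' => [f0 | fn0] H3 Es'.
  rewrite Es' f0 eqxx !E4 // E1 E2; split=> //; split.
    move=> v ltv; case: F => F1 _; split=> sv.
      rewrite F1 ?sv //=; last by lia.
      by rewrite negbK; apply/eqP; apply: H3; exists v => //; right.
    rewrite F1 ?sv //=; last by lia.
    by rewrite negbK; apply/eqP; apply: H3; exists v => //; left.
  by split=> //; apply: out0P => j ltj; apply: C.
have [lx rx sx] := H3.
have arcs3 : arcs_in N M (arr s3 atl) (arr s3 ahd) by rewrite !E4 // E1 E2.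
have F3 : forest N M (arr s3 asrc) (arr s3 atl) (arr s3 ahd) (arr s3 areach) (arr s3 apar) rk.
  by rewrite !E4 // E1 E2 E3.
have := run_walk erho k3 arcs3 F3 lx; rewrite (E4 areach) // => /(_ rx).
cbv zeta; rewrite -Es' !E4 // E1 E2 E3 => -[A1 A2 A3 A4]; split=> //.
have -> : var s' vfound = var s3 vfound by rewrite Es' run_var.
rewrite (negPf fn0) => S vS; move: (A4 S).
have -> : S (var s3 vx) = false.
  case: sx => v ltv [[-> sv]|[-> sv]]; have [V1 V2] := vS v ltv.
    by apply: negbTE; case/andP: (V2 sv).
  by apply: negbTE; case/andP: (V1 sv).
suff -> : S (var s' vx) by rewrite addn0.
case: (ltnP (var s' vx) n) => ltn; first exact: src_eq.
have [v E] : exists v, var s' vx = v + n by exists (var s' vx - n); lia.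
by rewrite E in A2 A3 *; apply: srcN_eq => //; lia.
Qed.

(** A valid set that no residual arc leaves is a minimum cut, since residual and initial out-degrees
    differ by the same [k] on all valid sets. [S0] is a valid set whose out-degree limits the number
    of augmentations. *)
Lemma run_max_flow rho s (S0 : pred nat) :
  let tl := arr s atl in let hd := arr s ahd in let src := arr s asrc in
  env rho -> konst n s -> arcs_in N M tl hd -> valid n src S0 ->
  let s' := run 8 rho (HFor 0 augment) s in
  let R : pred nat := fun y => arr s' areach y != 0 in
  [/\ arcs_in N M (arr s' atl) (arr s' ahd), valid n src R,
      out M (arr s' atl) (arr s' ahd) R = 0
    & exists k, forall S, valid n src S ->
        out M (arr s' atl) (arr s' ahd) S + k = out M tl hd S].
Proof.
move=> tl hd src erho ks arcs vS0 s' R.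
have e0 : rho 0 = base by case: erho.
pose P i s1 := let o := out M (arr s1 atl) (arr s1 ahd) in
  [/\ konst n s1, arr s1 asrc = src, arcs_in N M (arr s1 atl) (arr s1 ahd)
    & exists2 k, (forall S, valid n src S -> o S + k = out M tl hd S) &
      (valid n src (fun y => arr s1 areach y != 0) /\
       o (fun y => arr s1 areach y != 0) = 0) \/ k = i].
suff: P (rho 0) s'.
  rewrite e0; case=> _ _ A1 [k A2 A3]; case: A3 => [[A3 A4]|A3]; first by split=> //; exists k.
  (* If every round had augmented, [S0] would have lost [base] arcs, more than the [4m] there
     are. *)
  by have := A2 _ vS0; have := out_leq M tl hd S0; lia.
apply: run_for_ind; first by split=> //; exists 0 => [S _|]; [rewrite addn0 | right].
move=> i s1 _ [k1 E1 A1 [k A2 A3]].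
have := run_augment (env_fupd i (d := 8) isT erho) k1 A1; cbv zeta.
set s2 := run _ _ _ _; rewrite E1 => -[B1 B2].
split=> //; [exact: run_konst | by rewrite run_arr | ].
case: ifP B2 => _ B2.
  by case: B2 => [B2 [B3 B4]]; exists k; [move=> S vS; rewrite B4; apply: A2 | left].
exists k.+1 => [S vS|]; first by rewrite -(A2 S vS) -(B2 S vS); lia.
(* No augmentation succeeds after a failed one: the set found then is valid with out-degree 0, which
   cannot drop. *)
right; case: A3 => [[A3 A4]|-> //].
by have := B2 _ A3; rewrite A4 addn1.
Qed.

(** * Loading the double cover *)

Variable W : nat -> nat.

Local Notation uu := (fun e => W (e + e + 1)).
Local Notation ww := (fun e => W (e + e + 1 + 1)).

Lemma run_load_edge rho s e : konst n s -> arr s aword = W ->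
  let s' := run 8 (fupd rho 7 e) load_edge s in
  [/\ var s' vu = uu e, var s' vw = ww e & var s' vj = e + e].
Proof. by move=> [_ k1 _] Ew /=; rewrite /fupd /= k1 Ew. Qed.

Lemma run_put_arc d rho s x y : var s vone = 1 -> x != vj -> y != vj ->
  let s' := run d rho (put_arc x y) s in let j := var s vj in
  [/\ arr s' atl = fupd (arr s atl) j (var s x),
      arr s' ahd = fupd (arr s ahd) j (var s y), var s' vj = j + 1
    & forall z, z != vj -> var s' z = var s z].
Proof.
move=> k1 nx ny /=; rewrite {2 3}/fupd /= k1; split=> // z /negPf nz.
by rewrite /fupd nz.
Qed.

Lemma run_load_arcs1 rho s e : konst n s -> arr s aword = W ->
  let s' := run 8 (fupd rho 7 e) load_arcs s in
  let f (g : nat -> nat) a b c d := fun i =>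
    if i == 4 * e + 3 then d else if i == 4 * e + 2 then c
    else if i == 4 * e + 1 then b else if i == 4 * e then a else g i in
  (arr s' atl =1 f (arr s atl) (uu e) (ww e + n) (uu e + n) (ww e)) /\
  (arr s' ahd =1 f (arr s ahd) (ww e + n) (uu e) (ww e) (uu e + n)).
Proof.
move=> ks Ew s' f; have [kn k1 kz] := ks.
have [Lu Lw Lj] := run_load_edge rho e ks Ew.
rewrite /s' /load_arcs run_blk.
set s1 := run _ _ load_edge s in Lu Lw Lj *.
have kn1 : var s1 vn = n by rewrite /s1 run_var.
have k11 : var s1 vone = 1 by rewrite /s1 run_var.
have E1 a : a \notin warrs load_edge -> arr s1 a = arr s a by apply: run_arr.
clearbody s1; do 3 rewrite run_blk; set s2 := run _ _ _ (run _ _ _ (run _ _ _ s1)).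
have [Va Vc Vj] : [/\ var s2 va = uu e + n, var s2 vc = ww e + n & var s2 vj = 4 * e].
  by rewrite /s2 /= /fupd /= Lu Lw Lj kn1; split=> //; lia.
have [Vu Vw k2] : [/\ var s2 vu = uu e, var s2 vw = ww e & var s2 vone = 1] by [].
have E2 : arr s2 = arr s1 by [].
rewrite run_blk; case: (run_put_arc 8 (fupd rho 7 e) (x := vu) (y := vc) k2 isT isT).
set s3 := run _ _ _ s2 => T3 H3 J3 V3; clearbody s3.
have k3 : var s3 vone = 1 by rewrite V3.
rewrite run_blk; case: (run_put_arc 8 (fupd rho 7 e) (x := vc) (y := vu) k3 isT isT).
set s4 := run _ _ _ s3 => T4 H4 J4 V4; clearbody s4.
have k4 : var s4 vone = 1 by rewrite V4.
rewrite run_blk; case: (run_put_arc 8 (fupd rho 7 e) (x := va) (y := vw) k4 isT isT).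
set s5 := run _ _ _ s4 => T5 H5 J5 V5; clearbody s5.
have k5 : var s5 vone = 1 by rewrite V5.
rewrite run_blk; case: (run_put_arc 8 (fupd rho 7 e) (x := vw) (y := va) k5 isT isT).
set s6 := run _ _ _ s5 => T6 H6 J6 V6; clearbody s6.
rewrite run_nil T6 H6 T5 H5 T4 H4 T3 H3 J5 J4 J3 !V5 // !V4 // !V3 // Va Vc Vj Vu Vw E2 !E1 //.
by rewrite /f /fupd -!addnA; split.
Qed.

Lemma run_load_arcs rho s : konst n s -> env rho -> arr s aword = W ->
  let s' := run 7 rho (HFor 3 load_arcs) s in
  is_cover n m uu ww (arr s' atl) (arr s' ahd).
Proof.
move=> ks [_ _ _ e3 _] Ew s'.
pose P k s1 := [/\ konst n s1, arr s1 aword = W & is_cover n k uu ww (arr s1 atl) (arr s1 ahd)].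
suff: P (rho 3) s' by rewrite e3; case.
apply: run_for_ind; first by split=> // e.
move=> e s1 _ [k1 E1 C1]; have [T H] := run_load_arcs1 rho e k1 E1.
split; [exact: run_konst | by rewrite run_arr | move=> i].
set s2 := run _ _ _ _ in T H *; rewrite !T !H ltnS leq_eqVlt => /orP[/eqP ->|lti].
  have q c : (4 * e == 4 * e + c.+1) = false by lia.
  by rewrite !eqn_add2l !q !eqxx.
have ne a c : a < 4 -> (4 * i + a == 4 * e + c) = false by lia.
have ne0 c : (4 * i == 4 * e + c) = false by lia.
have ne1 a : a < 4 -> (4 * i + a == 4 * e) = false by lia.
have ne2 : (4 * i == 4 * e) = false by lia.
by rewrite !ne // !ne1 // !ne0 ne2; apply: C1.
Qed.

Hypothesis uu_lt : forall e, e < m -> uu e < n.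
Hypothesis ww_lt : forall e, e < m -> ww e < n.

Lemma cover_arcs_in tl hd : is_cover n m uu ww tl hd -> arcs_in N M tl hd.
Proof.
move=> C j ltj; have lte : j %/ 4 < m by lia.
have [[E1 E2] [E3 E4] [E5 E6] [E7 E8]] := C _ lte.
have lu := uu_lt lte; have lw := ww_lt lte.
have : j %% 4 < 4 by lia.
case Ej : (j %% 4) => [|[|[|[|k]]]] // _.
- have -> : j = 4 * (j %/ 4) by lia.
  by rewrite E1 E2; lia.
- have -> : j = 4 * (j %/ 4) + 1 by lia.
  by rewrite E3 E4; lia.
- have -> : j = 4 * (j %/ 4) + 2 by lia.
  by rewrite E5 E6; lia.
- have -> : j = 4 * (j %/ 4) + 3 by lia.
  by rewrite E7 E8; lia.
Qed.

Lemma valid_antitone (src src' : nat -> nat) S :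
  (forall y, src y != 0 -> src' y != 0) -> valid n src' S -> valid n src S.
Proof.
by move=> le V v ltv; have [V1 V2] := V v ltv; split=> /le; [apply: V1 | apply: V2].
Qed.

Lemma valid_fupd src z y : y < N -> valid n src (node n z) -> node n z y ->
  valid n (fupd src y 1) (node n z).
Proof.
move=> lty V zy v ltv; have [V1 V2] := V v ltv; rewrite nodeN in V1 V2 *.
rewrite /fupd; split.
  case: (eqVneq v y) => [E _|_ //].
  by move: zy; rewrite -E /node ltv => ->.
case: (eqVneq (v + n) y) => [E _|_ //].
by move: zy; rewrite -E nodeN /node ltv => ->.
Qed.

(** * Fixing the vertices after a correct guess *)

Section Pair.
Variables (b t : nat) (col : pred nat).
Hypothesis good_edge : forall e, e < m ->
  [|| col (uu e) != col (ww e), uu e \in [:: b; t] | ww e \in [:: b; t]].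
Hypothesis b_lt : b < n.
Hypothesis t_lt : t < n.

Local Notation opt := (optimal m uu ww).

Definition fixed (src : nat -> nat) v : bool := (src v != 0) || (src (v + n) != 0).

(** The invariant keeps some optimal [z1] compatible with all marks, and residual out-degrees equal
    to those of the cover up to a constant on sets valid for the current marks. New marks leave
    fewer valid sets, so this constant survives them. Once all vertices are marked, the marks are
    [z1]. *)
Lemma run_fix_vertices rho s z : konst n s -> env rho ->
  let src := arr s asrc in
  is_cover n m uu ww (arr s atl) (arr s ahd) ->
  fixed src b -> fixed src t -> opt z -> valid n src (node n z) ->
  let s' := run 7 rho (HFor 1 fix_vertex) s in
  opt (fun v => arr s' asrc v != 0).
Proof.
move=> ks erho src C fb ft oz vz s'.
set D := out M (arr s atl) (arr s ahd).
pose P k s1 := let src1 := arr s1 asrc in [/\ konst n s1,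
  arcs_in N M (arr s1 atl) (arr s1 ahd),
  exists k', forall S, valid n src1 S -> out M (arr s1 atl) (arr s1 ahd) S + k' = D S,
  exists2 z1, opt z1 & valid n src1 (node n z1)
  & [/\ fixed src1 b, fixed src1 t & forall v, v < k -> fixed src1 v]].
have e1 : rho 1 = n by case: erho.
suff: P (rho 1) s'.
  rewrite e1; case=> _ _ _ [z1 o1 v1] [_ _ f1] z'.
  rewrite (_ : unc m uu ww _ = unc m uu ww z1); first exact: o1.
  have E v : v < n -> (arr s' asrc v != 0) = z1 v.
    move=> ltv; have [V1 V2] := v1 v ltv; rewrite nodeN /node ltv in V1 V2.
    case/orP: (f1 v ltv) => sv; first by case/andP: (V1 sv) => ->; rewrite sv.
    case/andP: (V2 sv) => /negPf zv _; rewrite zv; apply: contraFF zv => sv'.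
    by case/andP: (V1 sv').
  by apply: eq_bigr => e _; rewrite !E ?uu_lt ?ww_lt.
apply: run_for_ind.
  split=> //; first exact: cover_arcs_in C; last by exists z.
  by exists 0 => S _; rewrite addn0.
move=> v s1; rewrite e1 => ltv [k1 A1 [k A2] [z1 o1 v1] [fb1 ft1 f1]].
rewrite /fix_vertex run_blk.
have := run_max_flow (env_fupd v (d := 7) isT erho) k1 A1 v1; cbv zeta.
set s2 := run _ _ (HFor 0 augment) s1 => -[B1 B2 B3 [k' B4]].
have E2 : arr s2 asrc = arr s1 asrc by apply: run_arr.
have k2 : konst n s2 by apply: run_konst.
set R : pred nat := fun y => arr s2 areach y != 0 in B2 B3 *.
(* [R] has residual out-degree 0, and passing from the residual graph back to the cover adds the
   same constant to every valid set. *)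
have minR S : valid n (arr s1 asrc) S -> D R <= D S.
  by move=> vS; rewrite -(A2 S vS) -(A2 R B2) -(B4 S vS) -(B4 R B2) B3; lia.
have [z' [oz' vz' z'v]] :=
  min_cut_optimal uu_lt ww_lt good_edge C b_lt t_lt fb1 ft1 o1 v1 B2 minR ltv.
set s3 := run _ _ _ _.
have [k3 E3 E4 E5]: [/\ konst n s3, arr s3 atl = arr s2 atl, arr s3 ahd = arr s2 ahd
    & arr s3 asrc = fupd (arr s1 asrc) (if R (v + n) then v + n else v) 1].
  split; [exact: run_konst | by rewrite /s3 run_arr | by rewrite /s3 run_arr | ].
  have [kn ko _] := k2; rewrite -E2 /s3 /R; move: (s2) kn ko => s4 kn ko /=.
  case h: (arr s4 areach (v + n) == 0); by do 2 rewrite /fupd /= ?kn ?h ?ko.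
have mono y : arr s1 asrc y != 0 -> arr s3 asrc y != 0.
  by rewrite E5 /fupd; case: ifP.
have fmono u : fixed (arr s1 asrc) u -> fixed (arr s3 asrc) u.
  by case/orP=> /mono su; rewrite /fixed su ?orbT.
split=> //; rewrite ?E3 ?E4 //.
- exists (k' + k) => S /(valid_antitone mono) vS.
  by rewrite addnA B4 // A2.
- exists z' => //; rewrite E5; apply: valid_fupd => //; first by case: ifP; lia.
  case: ifP => Rv; first by rewrite nodeN z'v Rv.
  by rewrite /node ltv z'v Rv.
- split; [exact: fmono | exact: fmono | move=> u].
  rewrite ltnS leq_eqVlt => /orP[/eqP ->|/f1 /fmono //].
  by rewrite /fixed E5; case: (R (v + n)); rewrite /fupd eqxx ?orbT.
Qed.

(** Analyses only the iteration whose guessed nodes agree with an optimal [z]. *)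
Lemma run_solve_pair rho s z : konst n s -> env rho -> arr s aword = W ->
  opt z -> rho 5 = (if z b then b else b + n) -> rho 6 = (if z t then t else t + n) ->
  opt (fun v => arr (run 7 rho solve_pair s) asrc v != 0).
Proof.
move=> ks erho Ew oz r5 r6; rewrite /solve_pair run_blk.
set s1 := run _ _ _ s.
have k1 : konst n s1 by apply: run_konst.
have Ew1 : arr s1 aword = W by rewrite /s1 run_arr.
have src0 y : y < N -> arr s1 asrc y = 0.
  have e2 : rho 2 = N by case: erho.
  suff: konst n s1 /\ forall y, y < rho 2 -> arr s1 asrc y = 0 by rewrite e2 => -[_]; apply.
  apply: (run_for_ind (P := fun k s1 => konst n s1 /\ forall y, y < k -> arr s1 asrc y = 0)) => //.
  move=> j s0 _ [k0 H]; split; first exact: run_konst.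
  move=> x; rewrite ltnS leq_eqVlt /= /fupd /=; have [_ _ ->] := k0.
  by case: (eqVneq x j) => //= _; apply: H.
rewrite run_blk; set s2 := run _ _ _ s1.
have k2 : konst n s2 by apply: run_konst.
have C := run_load_arcs k1 erho Ew1; cbv zeta in C; rewrite -/s2 in C.
have E2 : arr s2 asrc = arr s1 asrc by rewrite /s2 run_arr.
clearbody s2; do 4 rewrite run_blk; set s3 := run _ _ _ (run _ _ _ (run _ _ _ (run _ _ _ s2))).
have k3 : konst n s3 by [].
have E3 : arr s3 asrc = fupd (fupd (arr s2 asrc) (rho 5) 1) (rho 6) 1.
  by case: k2 => _ ko _; rewrite /s3 /= /fupd /= ko.
rewrite run_blk run_nil.
have fixed_node u (src : nat -> nat) : src (if z u then u else u + n) != 0 -> fixed src u.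
  by rewrite /fixed; case: (z u) => ->; rewrite ?orbT.
have node_lt u : u < n -> (if z u then u else u + n) < N by case: (z u); lia.
have node_in u : u < n -> node n z (if z u then u else u + n).
  by move=> ltu; case zu: (z u); rewrite ?nodeN ?zu // /node ltu.
apply: (run_fix_vertices (z := z)) => //; rewrite E3.
- by apply: fixed_node; rewrite -r5 /fupd eqxx; case: ifP.
- by apply: fixed_node; rewrite -r6 /fupd eqxx.
rewrite r5 r6; apply: valid_fupd; rewrite ?node_lt ?node_in //.
apply: valid_fupd; rewrite ?node_lt ?node_in // E2 => v ltv.
by rewrite !src0 //; lia.
Qed.

(** * The best set over all guesses *)

Definition cost (f : nat -> nat) : nat := unc m uu ww (fun v => f v != 0).

Lemma run_count rho s : konst n s -> env rho -> arr s aword = W -> var s vcost = 0 ->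
  var (run 7 rho (HFor 3 count_edge) s) vcost = cost (arr s asrc).
Proof.
move=> ks [_ _ _ e3 _] Ew c0; set s' := run _ _ _ _.
pose P k s1 := [/\ konst n s1, arr s1 aword = W, arr s1 asrc = arr s asrc &
  var s1 vcost = \sum_(e < k) ((arr s asrc (uu e) != 0) == (arr s asrc (ww e) != 0))].
suff: P (rho 3) s' by rewrite e3; case.
apply: run_for_ind; first by rewrite /P big_ord0.
move=> e s1 _ [k1 E1 E2 E3].
split; [exact: run_konst | by rewrite run_arr | by rewrite run_arr | ].
have [Lu Lw Lj] := run_load_edge rho e k1 E1.
rewrite /count_edge run_blk; set s2 := run _ _ load_edge s1 in Lu Lw Lj *.
have [_ ko _] : konst n s2 by apply: run_konst.
have E4 : arr s2 asrc = arr s asrc by rewrite /s2 run_arr.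
have E5 : var s2 vcost = var s1 vcost by rewrite /s2 run_var.
clearbody s2; rewrite big_ord_recr -E3 -E5 -E4 -Lu -Lw.
case h1: (arr s2 asrc (var s2 vu) == 0); case h2: (arr s2 asrc (var s2 vw) == 0);
by do 2 rewrite /= /fupd /= ?h1 ?h2 ?ko /= ?addn0.
Qed.

Lemma run_save rho s : konst n s -> env rho ->
  forall v, v < n ->
    arr (run 7 rho (HFor 1 save_vertex) s) abest v = (arr s asrc v != 0).
Proof.
move=> ks [_ e1 _ _ _]; set s' := run _ _ _ _.
pose P k s1 := [/\ konst n s1, arr s1 asrc = arr s asrc &
  forall v, v < k -> arr s1 abest v = (arr s asrc v != 0)].
suff: P (rho 1) s' by rewrite e1; case.
apply: run_for_ind; first by split.
move=> v s1 _ [k1 E1 H1]; split; [exact: run_konst | by rewrite run_arr | move=> u].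
have [_ ko kz] := k1.
rewrite ltnS leq_eqVlt -E1; case h: (arr s1 asrc v == 0);
do 2 rewrite /= /fupd /= ?h ?ko ?kz; rewrite E1; case: (eqVneq u v) => [->|_] //= H; rewrite ?H1 //;
by rewrite -E1 h.
Qed.

(** The value [m.+1] says that nothing has been recorded yet. The entries are kept at 0 or 1 because
    [abest] is output as it stands. *)
Definition best_inv (s : state) : Prop :=
  [/\ konst n s, arr s aword = W &
    var s vbest = m.+1 \/
    var s vbest = cost (arr s abest) /\ forall v, v < n -> arr s abest v <= 1].

Lemma run_record rho s : env rho -> best_inv s ->
  let s' := run 7 rho record_best s in
  [/\ best_inv s', var s' vbest <= var s vbest & var s' vbest <= cost (arr s asrc)].
Proof.
move=> erho [ks Ew H]; rewrite /record_best run_blk.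
set s1 := run _ _ _ s.
have k1 : konst n s1 by apply: run_konst.
have := run_count k1 erho (Ew : arr s1 aword = W) erefl.
rewrite run_blk; set s2 := run _ _ _ s1 => c2.
have k2 : konst n s2 by apply: run_konst.
have Ea a : arr s2 a = arr s a by rewrite /s2 run_arr.
have Eb : var s2 vbest = var s vbest by rewrite /s2 run_var.
clearbody s2; rewrite run_blk; set s3 := run _ _ _ s2.
have k3 : konst n s3 by apply: run_konst.
have V3 : var s3 vp = var s vbest - var s2 vcost by rewrite -Eb.
rewrite run_blk run_nil; set c := hblk _.
have -> : run 7 rho (HIf vp c HSkip) s3 = if var s3 vp == 0 then s3 else run 7 rho c s3 by [].
rewrite V3; have Ec : var s2 vcost = cost (arr s asrc) := c2; rewrite Ec.
case: eqP => le.
  split; [|by rewrite -Eb | by rewrite -[var s3 vbest]/(var s2 vbest) Eb; lia].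
  split=> //; first by rewrite -[arr s3]/(arr s2) Ea.
  by rewrite -[arr s3]/(arr s2) -[var s3 vbest]/(var s2 vbest) Eb Ea.
rewrite /c run_blk; set s4 := run _ _ _ s3.
have k4 : konst n s4 by apply: run_konst.
have V4 : var s4 vbest = cost (arr s asrc).
  by case: k3 => _ _ kz; rewrite /s4 /= /fupd /= -Ec -[var s2 vz]/(var s3 vz) kz addn0.
rewrite run_blk run_nil.
have := run_save k4 erho; set s5 := run _ _ _ s4 => H5.
have V5 : var s5 vbest = cost (arr s asrc) by rewrite -V4 /s5 run_var.
split; rewrite ?V5 //; last by lia.
split; first exact: run_konst.
  by rewrite /s5 run_arr // -[arr s4]/(arr s2) Ea.
right; rewrite V5; have E4 : arr s4 asrc = arr s asrc by rewrite -[arr s4]/(arr s2) Ea.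
split; last by move=> v ltv; rewrite H5 // leq_b1.
by apply: eq_bigr => e _; rewrite !H5 ?uu_lt ?ww_lt // E4 !eqb0 !negbK.
Qed.

Lemma run_search rho s : env rho -> best_inv s -> (exists z, opt z) ->
  let s' := run 5 rho search s in
  opt (fun v => arr s' abest v != 0) /\ forall v, v < n -> arr s' abest v <= 1.
Proof.
move=> erho I0 [z oz] s'.
set yb := if z b then b else b + n; set yt := if z t then t else t + n.
have ltyb : yb < N by rewrite /yb; case: (z b); lia.
have ltyt : yt < N by rewrite /yt; case: (z t); lia.
have e2 : rho 2 = N by case: erho.
pose Q s1 := var s1 vbest <= unc m uu ww z.
(* Every guess preserves the invariant without raising [vbest]; only the guess [(yb, yt)] has to
   reach the optimum. *)
have pair j i s1 : best_inv s1 ->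
    let s2 := run 7 (fupd (fupd rho 5 j) 6 i) (HSeq solve_pair record_best) s1 in
    [/\ best_inv s2, var s2 vbest <= var s1 vbest & j = yb -> i = yt -> Q s2].
  move=> [k1 E1 H1]; set rho' := fupd _ 6 i; rewrite run_seq.
  have erho' : env rho' by apply: env_fupd => //; apply: env_fupd.
  set s2 := run _ _ _ s1.
  have V2 : var s2 vbest = var s1 vbest by rewrite /s2 run_var.
  have I2 : best_inv s2.
    split; [exact: run_konst | by rewrite /s2 run_arr | ].
    by rewrite V2 /s2 run_arr.
  have [I3 le3 le3'] := run_record erho' I2.
  split=> //; first by rewrite -V2.
  move=> Ej Ei; apply: leq_trans le3' _.
  have := run_solve_pair k1 erho' E1 oz; rewrite -/s2 => /(_ _ _)/(_ _) H.
  by apply: H; rewrite /rho' /fupd.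
have inner j s1 : best_inv s1 ->
    let s2 := run 6 (fupd rho 5 j) (HFor 2 (HSeq solve_pair record_best)) s1 in
    [/\ best_inv s2, var s2 vbest <= var s1 vbest & j = yb -> Q s2].
  move=> I1 s2.
  pose P k s3 := [/\ best_inv s3, var s3 vbest <= var s1 vbest & j = yb -> yt < k -> Q s3].
  suff: P (fupd rho 5 j 2) s2.
    by rewrite [fupd _ _ _ _]e2; case=> A1 A2 A3; split=> // Ej; apply: A3.
  apply: run_for_ind; first by split.
  move=> i s3 _ [A1 A2 A3]; have [B1 B2 B3] := pair j i s3 A1.
  split=> //; first exact: leq_trans B2 A2.
  move=> Ej; rewrite ltnS leq_eqVlt => /orP[/eqP Ei|lti]; first exact: B3.
  exact: leq_trans B2 (A3 Ej lti).
pose P k s3 := best_inv s3 /\ (yb < k -> Q s3).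
have [[_ _ I'] Q'] : P (rho 2) s'.
  apply: run_for_ind; first by [].
  move=> j s3 _ [A1 A2]; have [B1 B2 B3] := inner j s3 A1.
  split=> //; rewrite ltnS leq_eqVlt => /orP[/eqP Ej|ltj]; first exact: B3.
  exact: leq_trans B2 (A2 ltj).
rewrite e2 in Q'; have {}Q' := Q' ltyb.
(* Excludes the initial value [m.+1], so a set has been recorded. *)
have zm : unc m uu ww z <= m.
  rewrite -[X in _ <= X](card_ord m) -sum1_card; apply: leq_sum => e _; exact: leq_b1.
case: I' => [E|[E I']]; first by move: Q'; rewrite /Q E; lia.
split=> // z'; apply: leq_trans (oz z'); rewrite -/(cost (arr s' abest)) -E.
exact: Q'.
Qed.

End Pair.

End Run.

(** * Recovering the parameters from the input *)

Lemma run_setup n m d rho s :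
  rho 0 = 64 * (2 * m + 1 + n) -> arr s aword 0 = n ->
  let s' := run d rho setup s in
  [/\ konst n s', var s' vN = n + n, var s' vy = 128 * m, var s' vp = 128 & var s' vm = 0].
Proof.
move=> r0 Wn; rewrite /setup; do 5 rewrite run_blk.
set s1 := run _ _ _ (run _ _ _ (run _ _ _ (run _ _ _ (run _ _ _ s)))).
have k1 : konst n s1 by split; rewrite /s1 /= /fupd /= ?Wn.
have [V1 V2] : var s1 vN = n + n /\ var s1 vy = 64 * (2 * m + 1 + n).
  by rewrite /s1 /= /fupd /= Wn r0.
clearbody s1; do 5 rewrite run_blk.
set s2 := run _ _ _ (run _ _ _ (run _ _ _ (run _ _ _ (run _ _ _ s1)))).
have k2 : konst n s2 by apply: run_konst.
have [V3 V4 V5] : [/\ var s2 vN = n + n, var s2 vy = 64 * (2 * m + 1 + n) & var s2 vp = 64 * n].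
  by rewrite /s2 /= /fupd /= V1 V2; split=> //; lia.
clearbody s2; set s3 := run _ _ _ s2.
have k3 : konst n s3 by apply: run_konst.
split=> //.
by rewrite /s3 /= /fupd /= V4 V5; lia.
Qed.

Lemma run_main n m rho s (b t : nat) (col : pred nat) :
  let W := arr s aword in
  let uu := fun e => W (e + e + 1) in let ww := fun e => W (e + e + 1 + 1) in
  rho 0 = 64 * (2 * m + 1 + n) -> W 0 = n ->
  (forall e, e < m -> uu e < n) -> (forall e, e < m -> ww e < n) ->
  (forall e, e < m ->
     [|| col (uu e) != col (ww e), uu e \in [:: b; t] | ww e \in [:: b; t]]) ->
  b < n -> t < n -> (exists z, optimal m uu ww z) ->
  let s' := run 1 rho main s in
  [/\ var s' vn = n, optimal m uu ww (fun v => arr s' abest v != 0)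
    & forall v, v < n -> arr s' abest v <= 1].
Proof.
move=> W uu ww r0 W0 ltu ltw good ltb ltt oz; rewrite /main run_blk.
have [k1 V1 V2 V3 V4] := run_setup 1 r0 W0; cbv zeta in *.
set s1 := run _ _ setup s in k1 V1 V2 V3 V4 *.
have E1 : arr s1 aword = W by rewrite /s1 run_arr.
clearbody s1; rewrite run_blk; set s2 := run _ _ _ s1.
have k2 : konst n s2 by apply: run_konst.
have E2 : arr s2 aword = W by rewrite /s2 run_arr.
have V5 : var s2 vN = n + n by rewrite /s2 run_var.
have V6 : var s2 vm = m.
  (* Each round takes 128 off [128 * m] until nothing is left; later rounds do nothing. *)
  pose P k s3 := [/\ konst n s3, var s3 vp = 128, var s3 vm = minn k m
    & var s3 vy = 128 * (m - minn k m)].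
  have [_ _ -> _] : P (rho 0) s2; last by rewrite r0; lia.
  apply: run_for_ind; first by split; rewrite ?V4 ?V2 ?min0n ?subn0.
  move=> j s3 _ [k3 A1 A2 A3].
  split; [exact: run_konst | by rewrite run_var | | ];
  have [_ ko _] := k3; case h: (var s3 vy == 0);
  rewrite /= ?h /= /fupd /= ?ko ?A1; move: h; rewrite A3 ?A2; lia.
clearbody s2; do 3 rewrite run_blk.
set s3 := run _ _ _ (run _ _ _ (run _ _ _ s2)).
have k3 : konst n s3 by apply: run_konst.
have E3 : arr s3 = arr s2 by [].
have [V7 V8 V9 V10] : [/\ var s3 vN = n + n, var s3 vm = m, var s3 vM = 4 * m & var s3 vbest = m.+1].
  by have [_ ko _] := k2; rewrite /s3 /= /fupd /= V5 V6 ko; split=> //; lia.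
clearbody s3; rewrite run_blk run_nil.
set rho' := fupd (fupd (fupd (fupd rho 1 (minn (var s3 vn) (rho 0)))
  2 (minn (var s3 vN) (rho 0))) 3 (minn (var s3 vm) (rho 0))) 4 (minn (var s3 vM) (rho 0)).
have -> : run 1 rho (HLet vn (HLet vN (HLet vm (HLet vM search)))) s3 = run 5 rho' search s3 by [].
have erho : env (64 * (2 * m + 1 + n)) n m rho'.
  have [kn _ _] := k3; rewrite /rho' kn V7 V8 V9 r0.
  by split; rewrite /fupd //=; lia.
have big : 4 * m < 64 * (2 * m + 1 + n) by lia.
have I3 : best_inv n m W s3 by split; rewrite ?E3 //; left.
have [H1 H2] := run_search big ltu ltw good ltb ltt erho I3 oz.
split=> //; by rewrite run_var //; case: k3.
Qed.

(** * Input and output *)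

(* The input occupies the low registers: the first 63 letters are saved above
   [base], computed in place in register 0, before those registers are reused. *)
Definition enter : seq instr :=
  [:: Add 0 0 1; Add 0 0 0; Add 0 0 0; Add 0 0 0; Add 0 0 0; Add 0 0 0; Add 0 0 0;
      Store 0 1; Const 1 8].

(** Unrolled, since only registers 0 and 1 are free: they hold the target address and the stride
    8. *)
Fixpoint save (k : nat) : cmd :=
  if k is k'.+1 then Seq (save k') (prims [:: Add 0 0 1; Store 0 k'.+2]) else Skip.

(** 496 is [8 * 62], the offset of the last letter saved, so subtracting it recovers [base]. The
    loop copies registers 64 to [base - 1], which covers the rest of the word; its targets lie above
    [base], so no source is overwritten. *)
Definition copy_init : seq instr :=
  [:: Const 1 496; Sub 2 0 1; Const 3 64; Const 5 1; Const 6 8; Add 4 0 6; Sub 0 2 3].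

Definition copy_step : seq instr :=
  [:: Fetch 7 3; Store 4 7; Add 3 3 5; Add 4 4 6; Sub 0 2 3].

(** The final instructions put [base] into register 4, which is slot 0. *)
Definition prelude : cmd :=
  Seq (prims enter) (Seq (save 62) (Seq (prims copy_init)
    (Seq (While 0 (prims copy_step)) (prims [:: Const 0 0; Add 4 2 0])))).

(** Entry 63 of array 1 lies at offset 505, that is [8 * 63 + 1]. Only the entries from 63 on are
    emitted by the loop; the earlier ones belong in registers that it still uses. *)
Definition emit_init : seq instr :=
  [:: Add 1 2 2; Const 0 2; Add 1 1 0; Store 1 3; Const 4 64; Const 5 1; Const 6 8;
      Const 7 505; Add 7 2 7; Add 8 3 5; Sub 0 8 4].

Definition emit_step : seq instr :=
  [:: Fetch 9 7; Store 4 9; Add 4 4 5; Add 7 7 6; Sub 0 8 4].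

(** The mirror image of [save]: register 0 descends through array 1 by the stride in register 1,
    starting for [k = 62] from the offset 497, that is [8 * 62 + 1]. *)
Fixpoint restore (k : nat) : cmd :=
  if k is k'.+1 then Seq (prims [:: Fetch k'.+2 0; Sub 0 0 1]) (restore k') else Skip.

(* The vertex count was stored at twice the address of the first output letter,
   so that register 0 can be loaded when no other register is free. *)
Definition postlude : cmd :=
  Seq (prims emit_init) (Seq (While 0 (prims emit_step))
    (Seq (prims [:: Const 0 497; Add 0 2 0; Const 1 8])
      (Seq (restore 62) (prims [:: Fetch 1 0; Add 0 0 0; Fetch 0 0])))).

(** * Verification of the relocations *)

Lemma ev_while_ind (P : nat -> memory -> Prop) l k m :
  all straight l -> P k m ->
  (forall i m1, P i m1 -> m1 0 = i) ->
  (forall i m1, P i.+1 m1 -> P i (exec_seq l m1)) ->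
  exists2 m', ev (While 0 (prims l)) m (k * (size l + 2) + 1) m' & P 0 m'.
Proof.
move=> sl; elim: k m => [|k IH] m Pm Pk PS.
  by exists m => //; apply: ev_while_false; apply: Pk.
have [m' E P'] := IH _ (PS _ _ Pm) Pk PS; exists m' => //.
have := ev_while_true (r := 0) (c := prims l) (m1 := m) _ (ev_prims m sl) E.
rewrite (Pk _ _ Pm) => /(_ isT).
by congr ev; lia.
Qed.

Local Ltac misses := repeat (case: eqP => [|_]; [lia | idtac]).

Section Prelude.
Variable w : seq nat.
Local Notation n := (nth 0 w 0).
Local Notation base := (64 * (size w + n)).
Hypothesis w_gt0 : 0 < size w.

Lemma save_ev k m : k <= 62 -> m 0 = base -> m 1 = 8 -> m base = n ->
  (forall x, 1 < x < base -> m x = input_memory w x) ->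
  exists m', [/\ ev (save k) m (2 * k) m', m' 0 = base + 8 * k, m' 1 = 8,
    forall i, i <= k -> m' (base + 8 * i) = nth 0 w i
    & forall x, 1 < x < base -> m' x = input_memory w x].
Proof.
move=> + m0 m1 mb mx; elim: k => [|k IH] lek.
  exists m; split=> //; rewrite ?addn0 //; first exact: ev_skip.
  by case=> // _; rewrite addn0.
have [m' [E A0 A1 A2 A3]] := IH (ltnW lek).
exists (exec_seq [:: Add 0 0 1; Store 0 k.+2] m').
have B : 64 <= base by lia.
split.
- have := ev_seq E (ev_prims (l := [:: Add 0 0 1; Store 0 k.+2]) m' isT).
  by congr ev => /=; lia.
- rewrite /exec_seq /= !set_regE /= A0 A1; case: eqP; lia.
- rewrite /exec_seq /= !set_regE /= A0 A1; case: eqP; lia.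
- move=> i lei; rewrite /exec_seq /= !set_regE /= A0 A1.
  case: (eqVneq i k.+1) => [->|nei].
    rewrite (_ : _ == _ = true); last by lia.
    by rewrite A3 //; lia.
  rewrite (_ : _ == _ = false); last by lia.
  rewrite (_ : _ == _ = false); last by lia.
  by apply: A2; lia.
- move=> x ltx; rewrite /exec_seq /= !set_regE /= A0 A1.
  rewrite (_ : _ == _ = false); last by lia.
  rewrite (_ : _ == _ = false); last by lia.
  exact: A3.
Qed.

Lemma prelude_ev : exists m',
  [/\ exists2 k, ev prelude (input_memory w) k m' & k <= 7 * base + 200,
      m' 2 = base, m' 4 = base & forall i, i < size w -> m' (base + 8 * i) = nth 0 w i].
Proof.
have B : 64 <= base by lia.
set m0 := input_memory w.
have [M0 M1] : m0 0 = size w /\ m0 1 = n by [].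
have [m1 [E1 A0 A1 A2 A3]] : exists m', [/\ ev (prims enter) m0 9 m', m' 0 = base, m' 1 = 8,
    m' base = n & forall x, 1 < x < base -> m' x = m0 x].
  exists (exec_seq enter m0); split; first exact: ev_prims.
  - rewrite /exec_seq /= !set_regE /= M0 M1; set v := (X in 0 == X).
    have -> : v = base by rewrite /v; lia.
    by case: eqP; lia.
  - by rewrite /exec_seq /= !set_regE.
  - rewrite /exec_seq /= !set_regE M0 M1 /=; case: eqP => [|_]; first by lia.
    set v := (X in base == X); have -> : v = base by rewrite /v; lia.
    by rewrite eqxx.
  - move=> x ltx; rewrite /exec_seq /= !set_regE M0 M1 /=; case: eqP => [|_]; first by lia.
    set v := (X in x == X); have -> : v = base by rewrite /v; lia.
    by do !(case: eqP => ?; first by lia).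
have [m2 [E2 B0 B1 B2 B3]] := save_ev (leqnn 62) A0 A1 A2 A3.
have := ev_prims (l := copy_init) m2 isT; set m3 := exec_seq _ _ => E3.
pose P k m := exists i, [/\ i.+1 + k = base, 63 <= i & [/\ m 0 = k, m 2 = base, m 3 = i.+1,
  m 4 = base + 8 * i & [/\ m 5 = 1, m 6 = 8,
  forall j, j < i -> m (base + 8 * j) = nth 0 w j
  & forall x, 64 <= x < base -> m x = m0 x]]].
have [|||m4 E4 P4] := @ev_while_ind P copy_step (base - 64) m3 isT.
- exists 63; split=> //; first by lia.
  split; [| | | |split] => //; rewrite ?/m3 /exec_seq /= ?set_regE /= ?B0 //; try lia.
    by move=> j ltj; rewrite ?set_regE; misses; apply: B2; lia.
  by move=> x ltx; rewrite ?set_regE; misses; apply: B3; lia.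
- by move=> i m [j [_ _ []]].
- move=> k m [i [C1 C2 [D0 D2 D3 D4 [D5 D6 D7 D8]]]].
  exists i.+1; split; [lia | lia |].
  have Dt : m 3 < base by lia.
  have DF r : r < 64 -> (r == base + 8 * i) = false by lia.
  have DF' r : r < 64 -> (base + 8 * i == r) = false by lia.
  rewrite /exec_seq /=; split; [| | | |split];
    rewrite ?set_regE /= ?D3 ?D4 ?D2 ?D5 ?D6 ?DF //=; try lia.
    move=> j ltj; rewrite ?set_regE /= ?D3 ?D4; case: (eqVneq j i) => [->|nej].
      by misses; rewrite eqxx D8 //; lia.
    by misses; apply: D7; lia.
  by move=> x ltx; rewrite ?set_regE /= ?D3 ?D4; misses; apply: D8.
case: P4 => i [C1 C2 [D0 D2 D3 D4 [D5 D6 D7 D8]]].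
exists (exec_seq [:: Const 0 0; Add 4 2 0] m4); split.
- exists (9 + (2 * 62 + (7 + ((base - 64) * (5 + 2) + 1 + 2)))); last by lia.
  have E5 := ev_prims (l := [:: Const 0 0; Add 4 2 0]) m4 isT.
  exact: ev_seq E1 (ev_seq E2 (ev_seq E3 (ev_seq E4 E5))).
- by rewrite /exec_seq /= !set_regE /= D2.
- by rewrite /exec_seq /= !set_regE /= D2 addn0.
- move=> j ltj; rewrite /exec_seq /= !set_regE; misses; apply: D7; lia.
Qed.

End Prelude.

Section Postlude.
Variables (base n : nat) (f : nat -> nat).
Hypothesis n_lt : n < base.
Hypothesis base_dvd : 64 %| base.

Lemma restore_ev k m : k <= 62 -> m 0 = base + 1 + 8 * k -> m 1 = 8 ->
  (forall i, m (base + 8 * i + 1) = f i) ->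
  exists m', [/\ ev (restore k) m (2 * k) m', m' 0 = base + 1,
    forall j, 1 < j < k + 2 -> m' j = f j.-1
    & forall x, k + 2 <= x -> m' x = m x].
Proof.
have B : 64 <= base by lia.
elim: k m => [|k IH] m lek m0 m1 mf.
  exists m; split=> //; [exact: ev_skip | by rewrite m0 addn0 | by lia].
set m2 := exec_seq [:: Fetch k.+2 0; Sub 0 0 1] m.
have Ex x : m2 x = if x == 0 then base + 1 + 8 * k else if x == k.+2 then f k.+1 else m x.
  rewrite /m2 /exec_seq /= !set_regE /= m0 m1.
  have -> : base + 1 + 8 * k.+1 = base + 8 * k.+1 + 1 by lia.
  rewrite mf; case: eqP => // _; lia.
have [||||m' [E A0 A1 A2]] := IH m2.
- by lia.
- by rewrite Ex.
- by rewrite Ex /= m1.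
- by move=> i; rewrite Ex; misses; apply: mf.
exists m'; split=> //.
- have := ev_seq (ev_prims (l := [:: Fetch k.+2 0; Sub 0 0 1]) m isT) E.
  by congr ev => /=; lia.
- move=> j ltj; case: (eqVneq j k.+2) => [->|nej]; last by apply: A1; lia.
  by rewrite A2 ?Ex ?eqxx //; lia.
- move=> x lex; rewrite A2 ?Ex; last by lia.
  by misses.
Qed.

Lemma postlude_ev m : m 2 = base -> m 3 = n ->
  (forall i, m (base + 8 * i + 1) = f i) ->
  exists m', [/\ exists2 k, ev postlude m k m' & k <= 7 * base + 200,
      m' 0 = n & forall i, i < n -> m' i.+1 = f i].
Proof.
move=> m2 m3 mf; have B : 64 <= base by lia.
have := ev_prims (l := emit_init) m isT; set m1 := exec_seq _ _ => E1.
have Ex x : 10 <= x -> m1 x = if x == base + base + 2 then n else m x.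
  by move=> lex; rewrite /m1 /exec_seq /= !set_regE /= m2 m3; misses.
have far : m1 (base + base + 2) = n by rewrite Ex ?eqxx //; lia.
(* [base] is a multiple of 8, so [base + base + 2] belongs to array 2 and the stored count spoils no
   entry of array 1. *)
have bf i : m1 (base + 8 * i + 1) = f i.
  by rewrite Ex ?mf; [misses | lia].
pose P k x := exists i, [/\ i + k = maxn n 63, 63 <= i & [/\ x 0 = k, x 2 = base, x 4 = i.+1,
  x 5 = 1 & [/\ x 6 = 8, x 7 = base + 8 * i + 1, x 8 = n.+1,
  forall j, 63 <= j < i -> x j.+1 = f j & forall y, base <= y -> x y = m1 y]]].
have [|||m4 E4 P4] := @ev_while_ind P emit_step (n - 63) m1 isT.
- exists 63; split=> //; first by lia.
  have DF r : r < 64 -> (r == base + base + 2) = false by lia.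
  rewrite /m1 /exec_seq /=; split; [| | | |split] => //;
    rewrite ?set_regE /= ?m2 ?m3 ?DF //; try lia.
- by move=> i x [j [_ _ []]].
- move=> k x [i [C1 C2 [D0 D2 D4 D5 [D6 D7 D8 D9 D10]]]].
  exists i.+1; split; [lia | lia |].
  have DF r : r < 64 -> (r == i.+1) = false by lia.
  have Dx : x (base + 8 * i + 1) = f i by rewrite D10 ?bf //; lia.
  rewrite /exec_seq /=; split; [| | | |split];
    rewrite ?set_regE /= ?D2 ?D4 ?D5 ?D6 ?D7 ?D8 ?DF //=; try lia.
    move=> j ltj; rewrite ?set_regE /= ?D7 ?D4; case: (eqVneq j i) => [->|nej].
      by rewrite eqxx /=; misses.
    by misses; apply: D9; lia.
  by move=> y ley; rewrite ?set_regE /= ?D7 ?D4; misses; apply: D10.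
case: P4 => i [C1 C2 [D0 D2 D4 D5 [D6 D7 D8 D9 D10]]].
have := ev_prims (l := [:: Const 0 497; Add 0 2 0; Const 1 8]) m4 isT.
set m5 := exec_seq _ _ => E5.
have F5 x : 2 <= x -> m5 x = m4 x.
  by move=> lex; rewrite /m5 /exec_seq /= !set_regE; misses.
have [||||m6 [E6 A0 A1 A2]] := @restore_ev 62 m5.
- by [].
- by rewrite /m5 /exec_seq /= !set_regE /= D2; lia.
- by [].
- by move=> j; rewrite F5 ?D10 ?bf //; lia.
have := ev_prims (l := [:: Fetch 1 0; Add 0 0 0; Fetch 0 0]) m6 isT.
set m7 := exec_seq _ _ => E7.
have F6 y : base <= y -> m6 y = m1 y.
  by move=> ley; rewrite A2 ?F5 ?D10 //; lia.
have F7 x : m7 x = if x == 0 then n else if x == 1 then f 0 else m6 x.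
  rewrite /m7 /exec_seq /= !set_regE /= A0.
  rewrite !(F6 (base + 1)); last by lia.
  have -> : base + 1 = base + 8 * 0 + 1 by lia.
  rewrite bf; case: eqP => // _.
  have -> : base + 8 * 0 + 1 + (base + 8 * 0 + 1) = base + base + 2 by lia.
  by misses; rewrite F6 ?far //; lia.
exists m7; split; last first.
- case=> [|j] ltj; rewrite F7 //=.
  case: (ltnP j.+2 64) => ltj'; first by rewrite A1.
  by rewrite A2 ?F5 ?D9 //; lia.
- by rewrite F7.
exists (11 + ((n - 63) * (5 + 2) + 1 + (3 + (2 * 62 + 3)))); last by lia.
exact: ev_seq E1 (ev_seq E4 (ev_seq E5 (ev_seq E6 E7))).
Qed.

End Postlude.

(** * Correctness and running time *)

Definition solver : cmd := Seq prelude (Seq (hcomp 1 main) postlude).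

Section Instance.
Variable G : mgraph.
Hypothesis abG : almost_bipartite G.

Local Notation n := (nvertices G).
Local Notation m := (size (edges G)).
Local Notation w := (graph_word G).
Local Notation uu := (fun e => nth 0 w (e + e + 1)).
Local Notation ww := (fun e => nth 0 w (e + e + 1 + 1)).

Lemma size_graph_word : size w = 2 * m + 1.
Proof.
rewrite /graph_word /= addn1; congr _.+1.
by elim: (edges G) => //= e s ->; rewrite mulnS.
Qed.

Lemma nth_edge x0 e : e < m ->
  uu e = (nth x0 (edges G) e).1 /\ ww e = (nth x0 (edges G) e).2.
Proof.
rewrite /graph_word !addn1 /=; elim: (edges G) e => // d s IH [|e] //= lte.
by rewrite addnS /=; apply: IH.
Qed.

Definition ext (A : {set 'I_n}) : pred nat := fun v => [exists i in A, i == v :> nat].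

Lemma extE (A : {set 'I_n}) (i : 'I_n) : ext A i = (i \in A).
Proof.
apply/exists_inP/idP => [[j jA /eqP/val_inj <-] //|iA].
by exists i => //; apply/eqP.
Qed.

Lemma unc_uncut (z : pred nat) (St : {set 'I_n}) :
  (forall i : 'I_n, z i = (i \in St)) -> unc m uu ww z = uncut St (~: St).
Proof.
(* The vertex [b] only supplies a default edge for [nth]. *)
move=> zE; have [b _] := abG; rewrite /uncut -sum1_count big_mkcond (big_nth (b, b)) big_mkord.
apply: eq_bigr => e _; have [-> ->] := nth_edge (b, b) (ltn_ord e).
by rewrite !zE !inE; case: (_ \in St); case: (_ \in St).
Qed.

Lemma optimal_exists : exists z, optimal m uu ww z.
Proof.
pose St := [arg min_(S < set0) uncut (G := G) S (~: S)].
exists (ext St) => z'; rewrite (unc_uncut (extE St)).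
rewrite (unc_uncut (z := z') (St := [set i : 'I_n | z' i])); last by move=> i; rewrite inE.
by rewrite /St; case: arg_minnP => // S _; apply.
Qed.

Lemma good_edges : exists b t : nat, exists col : pred nat,
  [/\ b < n, t < n & forall e, e < m ->
    [|| col (uu e) != col (ww e), uu e \in [:: b; t] | ww e \in [:: b; t]]].
Proof.
have [b [t [EH [E' [_ perm [X [Y [XY dXY bip]]] inc]]]]] := abG.
exists b, t, (ext X); split=> // e lte.
have [-> ->] := nth_edge (b, b) lte.
set d := nth _ _ e; have : d \in edges G by apply: mem_nth.
rewrite (perm_mem perm) mem_cat !extE => /orP[/bip|/inc].
  case/orP=> /andP[d1 d2].
    by rewrite d1 (disjointFl dXY d2).
  by rewrite d2 (disjointFl dXY d1).
rewrite /incident !inE -!(inj_eq val_inj) /= => /orP[] /orP[] ->; by rewrite ?orbT.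
Qed.

Local Notation base := (64 * (size w + n)).

Lemma solver_ev : exists k m',
  [/\ ev solver (input_memory w) k m', k <= time main base + 14 * base + 400
    & min_uncut_solution G (output_word m')].
Proof.
have w0 : nth 0 w 0 = n by [].
have wgt : 0 < size w by [].
have [m1 [[k1 E1 T1] A2 A4 A5]] := prelude_ev wgt; rewrite w0 in A2 A4 A5 T1.
have B : 64 <= base by lia.
(* The initial state is read off the memory, leftovers included, so nothing is assumed about unset
   variables and arrays. *)
pose s := State (fun x => m1 (vreg x)) (fun a i => m1 (base + 8 * i + a)).
pose rho (k : nat) := base.
have R1 : rep base 1 rho s m1 by split=> // -[].
have [k2 [m2 [E2 T2 R2]]] := hcomp_ev B (isT : 1 <= 30) main_wf (fun k _ => leqnn (rho k)) R1.
have [b [t [col [ltb ltt good]]]] := good_edges.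
have wE i : i < size w -> arr s aword i = nth 0 w i.
  by move=> lti; rewrite /= addn0 A5.
have uE e : e < m -> arr s aword (e + e + 1) = uu e.
  by move=> lte; apply: wE; rewrite size_graph_word; lia.
have vE e : e < m -> arr s aword (e + e + 1 + 1) = ww e.
  by move=> lte; apply: wE; rewrite size_graph_word; lia.
have ltE e : e < m -> (uu e < n) && (ww e < n).
  by move=> lte; have [-> ->] := nth_edge (Ordinal ltb, Ordinal ltb) lte; rewrite !ltn_ord.
have uncE z : unc m (fun e => arr s aword (e + e + 1)) (fun e => arr s aword (e + e + 1 + 1)) z
    = unc m uu ww z.
  by apply: eq_bigr => e _; rewrite uE ?vE.
have [] := @run_main n m rho s b t col.
- by rewrite /rho size_graph_word.
- by rewrite wE.
- by move=> e lte; rewrite uE //; case/andP: (ltE e lte).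
- by move=> e lte; rewrite vE //; case/andP: (ltE e lte).
- by move=> e lte; rewrite uE ?vE //; apply: good.
- exact: ltb.
- exact: ltt.
- by have [z oz] := optimal_exists; exists z => z'; rewrite !uncE.
set s' := run _ _ _ _ in R2 * => vn' opt' le1.
have [] := @postlude_ev base n (arr s' abest) _ _ m2 (rep_base R2).
- by lia.
- by rewrite dvdn_mulr.
- by rewrite -vn' -(rep_var R2 (x := 0)).
- by move=> i; rewrite (rep_arr R2).
move=> m3 [[k3 E3 T3] B0 B1].
exists (k1 + (k2 + k3)), m3; split; last 1 first.
- exists [set i : 'I_n | arr s' abest i != 0]; split.
    move=> S; rewrite -(unc_uncut (z := fun v => arr s' abest v != 0)); last first.
      by move=> i; rewrite inE.
    by rewrite -(unc_uncut (extE S)); have := opt' (ext S); rewrite !uncE.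
  rewrite /output_word /partition_word B0 /mkseq -val_enum_ord -map_comp.
  apply: eq_map => i /=; rewrite inE B1 //.
  by have := le1 _ (ltn_ord i); case: (arr s' abest i) => [|[|]].
- exact: ev_seq E1 (ev_seq E2 E3).
- have : k2 <= time main base by [].
  by lia.
Qed.

End Instance.

(** * Polynomial bounds *)

Definition polynomial (f : nat -> nat) : Prop :=
  exists p : {poly nat}, forall x, (p.[x])%R = f x.

Lemma polynomial_const c : polynomial (fun _ => c).
Proof. by exists c%:P%R => x; rewrite hornerC. Qed.

Lemma polynomial_id : polynomial id.
Proof. by exists 'X%R => x; rewrite hornerX. Qed.

Lemma polynomialD f g : polynomial f -> polynomial g -> polynomial (fun x => f x + g x).
Proof. by move=> [p Hp] [q Hq]; exists (p + q)%R => x; rewrite hornerD Hp Hq. Qed.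

Lemma polynomialM f g : polynomial f -> polynomial g -> polynomial (fun x => f x * g x).
Proof. by move=> [p Hp] [q Hq]; exists (p * q)%R => x; rewrite hornerM Hp Hq. Qed.

Lemma polynomialX f e : polynomial f -> polynomial (fun x => f x ^ e).
Proof.
move=> Hf; elim: e => [|e IH]; first exact: polynomial_const.
have [p Hp] := polynomialM Hf IH.
by exists p => x; rewrite Hp expnS.
Qed.

Theorem theorem6 :
  poly_time_solvable almost_bipartite graph_word graph_size min_uncut_solution.
Proof.
have [K HK] := ev_halts solver; have [e He] := time_poly main.
(* [q] bounds the array base [64 * (2 * m + 1 + n)] plus 2 in terms of [x = n + m], and [r] bounds
   the number of steps. *)
pose q x := 128 * (x + 1) + 600.
pose r x := q x ^ e + 14 * q x + 400.
have Cq : polynomial q.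
  apply: polynomialD (polynomial_const _); apply: polynomialM (polynomial_const _) _.
  exact: polynomialD polynomial_id (polynomial_const _).
have Cr : polynomial r.
  apply: polynomialD (polynomial_const _); apply: polynomialD (polynomialX e Cq) _.
  exact: polynomialM (polynomial_const _) Cq.
have [p Hp] : polynomial (fun x => r x * (5 * (K + q x + r x + 1))).
  apply: polynomialM (Cr) _; apply: polynomialM (polynomial_const _) _.
  apply: polynomialD (polynomial_const _); apply: polynomialD Cr.
  exact: polynomialD (polynomial_const _) Cq.
exists (asm solver 0), p => G abG; rewrite Hp.
have [k [m' [E T S]]] := solver_ev abG.
set B := 64 * _ in T.
(* The length and all letters are at most [B], hence below [2 ^ B]; this crude bit bound is still
   polynomial. *)
have inB : mem_below (K + B) (input_memory (graph_word G)).
  move=> i; apply: (@leq_trans (2 ^ B)); last by rewrite leq_exp2l // leq_addl.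
  apply: leq_ltn_trans (ltn_expl B (ltnSn 1)).
  have ltn0 : 0 < nvertices G by have [b _] := abG; have := ltn_ord b; lia.
  have szw := size_graph_word G.
  suff: all (leq^~ B) (size (graph_word G) :: graph_word G).
    move=> /(all_nthP 0) H; rewrite /input_memory.
    by case: (ltnP i (size (size (graph_word G) :: graph_word G))) => [/H //|h]; rewrite nth_default.
  have [B1 B2] : size (graph_word G) <= B /\ nvertices G <= B by rewrite /B; lia.
  apply/and3P; split; [exact: B1 | exact: B2 | ].
  apply/allP => x /flattenP[_ /mapP[d _ ->]]; rewrite !inE => /orP[] /eqP ->;
  apply: ltnW; apply: leq_trans (ltn_ord _) B2.
have [c hc lec] := HK _ _ _ _ inB (leq_addr B K) E.
exists (output_word m'), c; split=> //; first by exists m'.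
apply: leq_trans lec _.
set x := graph_size G.
have leB : B.+2 <= q x by rewrite /B /q /x size_graph_word /graph_size; lia.
have leB' : B <= q x by lia.
have lek : k <= r x.
  apply: leq_trans T _; rewrite leq_add2r leq_add //.
    by apply: leq_trans (He B) _; case: (posnP e) => [-> //|e0]; rewrite leq_exp2r.
  by rewrite leq_mul2l leB' orbT.
apply: leq_mul => //; rewrite leq_mul2l addn1 ltnS /=.
by apply: leq_add => //; rewrite leq_add2l.
Qed.
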